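(* (Block complex step approximation, first order Fréchet derivative.) Let $A_0,E_1$ be complex $n\times n$ matrices and let $f$ be analytic on an open set $\Omega\subseteq\mathbb{C}$ containing the spectrum of $A_0$ and such that $f(A)$ is real-valued for real matrices $A$. For real $h\neq 0$ let $$X_1=\begin{bmatrix}A_0 & hE_1\\ -hE_1 & A_0\end{bmatrix}.$$ Then, as $h\to 0$, $$L_f(A_0,E_1)=\frac{1}{h}\,[f(X_1)]_{1,2}+O(h^2),$$ where $[\cdot]_{1,2}$ denotes the upper right $n\times n$ block.
   Context: $f(A)$ denotes the matrix function in the standard sense (for square matrices of any size with spectrum in $\Omega$). ''Real-valued for real matrices'' means: $f(A)$ is real for every real square matrix $A$ with spectrum in $\Omega$. $L_f(A,E)$ is the Fréchet derivative: the unique mapping, linear in $E$, with $L_f(A,E)=f(A+E)-f(A)+o(\|E\|)$. *)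

(* Defs.v *)
(* The complex numbers are R[i], for R : realType, with the MathComp-Analysis
   notions of limit, differential and Landau symbol. *)
From HB Require Import structures.
From mathcomp Require Import all_boot all_order all_algebra.
From mathcomp Require Import all_classical all_reals all_analysis.
From mathcomp Require Import complex.

Set Implicit Arguments.
Unset Strict Implicit.
Unset Printing Implicit Defensive.

Import Order.TTheory GRing.Theory Num.Theory.
Import numFieldNormedType.Exports.

Local Open Scope classical_set_scope.
Local Open Scope complex_scope.
Local Open Scope ring_scope.

(* The modulus topology on R[i]; norms of complex matrices take values in
   R[i], with the (partial) order in which positive elements are real. *)
HB.instance Definition _ (R : rcfType) := NormedModule.copy R[i] R[i]^o.

Definition spectrum (F : fieldType) (n : nat) (A : 'M[F]_n) : set F :=
  [set a | eigenvalue A a].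

Definition analytic_on (R : realType) (D : set R[i]) (f : R[i] -> R[i]) : Prop :=
  forall z0, D z0 -> exists a : nat -> R[i],
    \forall z \near z0, series (fun k => a k * (z - z0) ^+ k) @ \oo --> f z.

(* p is the Hermite interpolant of f on the spectrum of A: with psi the minimal
   polynomial of A, deg p < deg psi, and p^(j)(a) = f^(j)(a) for every
   eigenvalue a and every j below the multiplicity of a as a root of psi.  The
   left-hand derivative is the formal one, the right-hand one is the complex
   derivative. *)
Definition hermite_interp (R : realType) (n : nat) (f : R[i] -> R[i])
    (A : 'M[R[i]]_n.+1) (p : {poly R[i]}) : Prop :=
  (size p < size (mxminpoly A))%N /\
  forall a, spectrum A a -> forall j, (j < mup a (mxminpoly A))%N ->
    p^`(j).[a] = f^`(j)%classic a.

(* The matrix function f(A) := p(A), p the Hermite interpolant, which exists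
   and is unique for all f and A (so that the default value 0 is never used);
   f(A) is meaningful when the derivatives of f involved exist, in particular
   when f is analytic on an open set containing the spectrum of A. *)
Definition mxfun (R : realType) (n : nat) (f : R[i] -> R[i])
    (A : 'M[R[i]]_n.+1) : 'M[R[i]]_n.+1 :=
  horner_mx A (xget 0 [set p | hermite_interp f A p]).

Definition real_on_real (R : realType) (D : set R[i]) (f : R[i] -> R[i]) : Prop :=
  forall (m : nat) (A : 'M[R[i]]_m.+1), A \is a mxOver Num.real ->
    spectrum A `<=` D -> mxfun f A \is a mxOver Num.real.

Definition cstep_mx (R : realType) (n : nat) (A0 E1 : 'M[R[i]]_n) (h : R) :
    'M[R[i]]_(n + n) :=
  block_mx A0 (h%:C *: E1) (- (h%:C *: E1)) A0.

(* Main.v *)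
Require Import Defs.
From HB Require Import structures.
From mathcomp Require Import all_boot all_order all_algebra.
From mathcomp Require Import all_classical all_reals all_analysis.
From mathcomp Require Import complex ring lra.

(* Newton interpolation. Divided differences of a function that is a convergent
   power series on small disjoint discs around finitely many centers stay bounded
   as long as the nodes stay close to the centers.  With [q] the characteristic
   polynomial of [A0] and [chi] that of a matrix [A], interpolating [f] first at
   the roots of [q ^+ 3] and then at those of [chi] gives
     f = p + q ^+ 3 * (g + chi * G)
   near the spectrum of [A0], where [p] is fixed and the coefficients of [g] are
   bounded when [A] is close to a matrix [B] such that [q(B) = 0].  Hence
     f(A) = p(A) + q(A) ^+ 3 * g(A) = p(A) + O(|A - B| ^ 3),
   since [q(A) = O(|A - B|)].  Taking [B = A0], and then [B = diag(A0, A0)] with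
   [A] the block matrix [X1], reduces both claims to the polynomial [p], for which
   the upper right block of [X1 ^+ k] is computed by induction on [k]. *)

Set Implicit Arguments.
Unset Strict Implicit.
Unset Printing Implicit Defensive.

Import Order.TTheory GRing.Theory Num.Theory.
Import numFieldNormedType.Exports.

Local Open Scope classical_set_scope.
Local Open Scope complex_scope.
Local Open Scope ring_scope.

(** * Modulus of complex numbers *)

Section ComplexModulus.
Variable R : realType.
Local Notation C := R[i].
Implicit Types (z w : C) (u : nat -> C).

(* The modulus with values in [R]: the norm of [R[i]] takes values in [R[i]],
   whose order is only partial. *)
Definition cnorm z : R := complex.Re `|z|.

Lemma cnormE z : `|z| = (cnorm z)%:C.
Proof. by []. Qed.

Lemma cnorm_ge0 z : 0 <= cnorm z.
Proof. by rewrite -ler0c -cnormE normr_ge0. Qed.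

Lemma cnorm0 : cnorm 0 = 0.
Proof. by apply: complexI; rewrite -cnormE normr0. Qed.

Lemma cnorm1 : cnorm 1 = 1.
Proof. by apply: complexI; rewrite -cnormE normr1. Qed.

Lemma cnorm_eq0 z : (cnorm z == 0) = (z == 0).
Proof. by rewrite -(inj_eq (@complexI R)) -cnormE -[0%:C]/(0 : C) normr_eq0. Qed.

Lemma cnorm_gt0 z : (0 < cnorm z) = (z != 0).
Proof. by rewrite lt_neqAle cnorm_ge0 andbT eq_sym cnorm_eq0. Qed.

Lemma cnormM z w : cnorm (z * w) = cnorm z * cnorm w.
Proof. by apply: complexI; rewrite rmorphM /= -!cnormE normrM. Qed.

Lemma cnormX z k : cnorm (z ^+ k) = cnorm z ^+ k.
Proof. by elim: k => [|k IH]; rewrite ?expr0 ?cnorm1 // !exprS cnormM IH. Qed.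

Lemma cnormN z : cnorm (- z) = cnorm z.
Proof. by apply: complexI; rewrite -!cnormE normrN. Qed.

Lemma cnormV z : cnorm z^-1 = (cnorm z)^-1.
Proof. by apply: complexI; rewrite fmorphV /= -!cnormE normfV. Qed.

Lemma cnormD z w : cnorm (z + w) <= cnorm z + cnorm w.
Proof. by rewrite -lecR rmorphD /= -!cnormE ler_normD. Qed.

Lemma cnormB z w : cnorm (z - w) <= cnorm z + cnorm w.
Proof. by rewrite -[cnorm w]cnormN cnormD. Qed.

Lemma cnorm_distC z w : cnorm (z - w) = cnorm (w - z).
Proof. by rewrite -cnormN opprB. Qed.

Lemma cnorm_subD z w : cnorm z - cnorm w <= cnorm (z - w).
Proof. by rewrite lerBlDr -{1}(subrK w z) cnormD. Qed.

Lemma cnorm_real (x : R) : cnorm x%:C = `|x|.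
Proof. by rewrite /cnorm normc_def /= expr0n /= addr0 sqrtr_sqr. Qed.

Lemma cnorm_nat k : cnorm k%:R = k%:R.
Proof. by rewrite -(rmorph_nat (real_complex R)) cnorm_real ger0_norm. Qed.

Lemma cnorm_sum I (r : seq I) (P : pred I) (F : I -> C) :
  cnorm (\sum_(i <- r | P i) F i) <= \sum_(i <- r | P i) cnorm (F i).
Proof.
elim/big_ind2: _ => [|x1 x2 y1 y2 h1 h2|//]; first by rewrite cnorm0.
by rewrite (le_trans (cnormD _ _)) // lerD.
Qed.

Lemma cnorm_Re z : `|complex.Re z| <= cnorm z.
Proof. by rewrite -lecR -cnormE normc_ge_Re. Qed.

Lemma cnorm_Im z : `|complex.Im z| <= cnorm z.
Proof.
have := cnorm_Re (z * 'i%C); rewrite ReiNIm normrN cnormM.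
suff -> : cnorm 'i%C = 1 by rewrite mulr1.
by rewrite /cnorm normc_def /= expr0n /= add0r expr1n sqrtr1.
Qed.

Lemma gt0_complexE (e : C) : 0 < e -> exists2 d : R, 0 < d & e = d%:C.
Proof.
move=> e0; exists (complex.Re e).
  by move: e0; rewrite ltcE => /andP[].
by rewrite RRe_real // gtr0_real.
Qed.

Lemma nbhs_cnormP z0 (P : set C) :
  (\forall z \near z0, P z) <->
  exists2 r : R, 0 < r & forall z, cnorm (z - z0) < r -> P z.
Proof.
split=> [|[r r0 H]].
  move/nbhs_ballP => [e /= /gt0_complexE [d d0 ->] H]; exists d => // z zd.
  by apply: H; rewrite -ball_normE /= cnormE ltcR cnorm_distC.
apply/nbhs_ballP; exists r%:C => /=; first by rewrite ltcR.
by move=> z; rewrite -ball_normE /= cnormE ltcR cnorm_distC => /H.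
Qed.

Lemma cvg_cnormP (T : Type) (F : set_system T) (FF : Filter F) (u : T -> C) l :
  (u @ F --> l) <-> ((fun k => cnorm (u k - l)) @ F --> (0 : R)).
Proof.
split=> H.
  apply/cvgrPdist_lt => e e0; near=> k.
  rewrite sub0r normrN (ger0_norm (cnorm_ge0 _)) cnorm_distC -ltcR -cnormE.
  by near: k; apply: (cvgrPdist_lt _ _).1 => //; rewrite ltcR.
apply/cvgrPdist_lt => e /gt0_complexE [d d0 ->]; near=> k.
rewrite cnormE ltcR cnorm_distC -[X in X < _]ger0_norm ?cnorm_ge0 //.
rewrite -normrN -sub0r.
by near: k; apply: (cvgrPdist_lt _ _).1.
Unshelve. all: by end_near. Qed.

Lemma cvg0_cnorm_le u (v : nat -> R) : (forall k, cnorm (u k) <= v k) ->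
  v @ \oo --> (0 : R) -> u @ \oo --> (0 : C).
Proof.
move=> uv v0; apply/cvg_cnormP; apply: squeeze_cvgr (cvg_cst 0) v0.
by near=> k; rewrite cnorm_ge0 subr0 uv.
Unshelve. all: by end_near. Qed.

Lemma cvg_cnorm_le u l v (B : R) (K : nat) : u @ \oo --> l ->
  (forall k, (K <= k)%N -> cnorm (u k - v) <= B) -> cnorm (l - v) <= B.
Proof.
move=> /cvg_cnormP ul uB; apply/ler_addgt0Pr => e e0.
have [k Kk] : exists2 k, (K <= k)%N & cnorm (u k - l) < e.
  have /(_ _ _ e0) := (cvgrPdist_lt _ _).1 ul.
  move=> [K' _ /(_ (maxn K K') (leq_maxr _ _))] /=.
  rewrite sub0r normrN ger0_norm ?cnorm_ge0 // => ?.
  by exists (maxn K K'); rewrite ?leq_maxl.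
move=> ke; rewrite -(subrKA (u k)) (le_trans (cnormD _ _)) // addrC lerD ?uB //.
by rewrite cnorm_distC ltW.
Qed.

(** The real and imaginary parts are each dominated by the geometric series, so both real series
    converge absolutely; their limits are then assembled into a complex one. *)
Lemma is_cvg_series_geometric_bound u (M t : R) : 0 <= t < 1 ->
  (forall k, cnorm (u k) <= M * t ^+ k) -> cvgn (series u).
Proof.
move=> /andP[t0 t1] uM.
have M0 : 0 <= M by have := uM 0%N; rewrite expr0 mulr1; apply/le_trans/cnorm_ge0.
have gc : cvgn (series (geometric M t)).
  by apply: is_cvg_geometric_series; rewrite ger0_norm.
have rc (v : nat -> R) : (forall k, `|v k| <= cnorm (u k)) -> cvgn (series v).
  move=> vu; apply: normed_cvg.
  apply: series_le_cvg gc => k //=; first by rewrite mulr_ge0 // exprn_ge0.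
  exact: le_trans (vu k) (uM k).
have /cvg_ex[a ca] := rc _ (fun k => cnorm_Re (u k)).
have /cvg_ex[b cb] := rc _ (fun k => cnorm_Im (u k)).
apply/cvg_ex; exists (a +i* b); apply/cvg_cnormP.
have sE n : series u n = series (fun k => complex.Re (u k)) n
    +i* series (fun k => complex.Im (u k)) n.
  rewrite /series /=; elim: n => [|n IH]; first by rewrite !big_geq.
  by rewrite !big_nat_recr //= IH; case: (u n).
apply: (@squeeze_cvgr _ _ _ _ (fun=> 0)
    (fun n => `|series (fun k => complex.Re (u k)) n - a|
            + `|series (fun k => complex.Im (u k)) n - b|)); last 2 first.
- exact: cvg_cst.
- rewrite -[0 : R]addr0; apply: cvgD.
    have -> : (0 : R) = `|a - a| by rewrite subrr normr0.
    by apply: cvg_norm; apply: cvgB ca (cvg_cst _).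
  have -> : (0 : R) = `|b - b| by rewrite subrr normr0.
  by apply: cvg_norm; apply: cvgB cb (cvg_cst _).
near=> n; rewrite cnorm_ge0 /= sE.
set x := series _ n - a; set y := series _ n - b.
rewrite [X in cnorm X](_ : _ = x%:C + 'i%C * y%:C); last first.
  by rewrite /x /y; apply/eqP; rewrite eq_complex /=; apply/andP; split; apply/eqP;
    ring.
rewrite (le_trans (cnormD _ _)) // cnormM !cnorm_real lerD //.
by rewrite /cnorm normc_def /= expr0n /= add0r expr1n sqrtr1 mul1r.
Unshelve. all: by end_near. Qed.

End ComplexModulus.

(** * Power series with geometrically bounded coefficients *)

Section BoundedPowerSeries.
Variable R : realType.
Local Notation C := R[i].
Implicit Types (a b d : nat -> C) (g : C -> C) (z w c : C) (rho M : R).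

Definition psum a w (K : nat) : C := series (fun k => a k * w ^+ k) K.

(* The bound on the coefficients is uniform in the data and survives divided
   differences, which is what makes Newton coefficients locally bounded. *)
Definition has_pseries rho M a g : Prop :=
  (forall k, cnorm (a k) * rho ^+ k <= M) /\
  (forall w, cnorm w < rho -> psum a w @ \oo --> g w).

Lemma psum0 a w : psum a w 0 = 0.
Proof. by rewrite /psum /series /= big_geq. Qed.

Lemma psumS a w K : psum a w K.+1 = psum a w K + a K * w ^+ K.
Proof. by rewrite /psum /series /= big_nat_recr. Qed.

Lemma has_pseries_ge0 rho M a g : has_pseries rho M a g -> 0 <= M.
Proof.
by case=> /(_ 0%N); rewrite expr0 mulr1 => + _; apply/le_trans/cnorm_ge0.
Qed.

Lemma has_pseries_weaken rho rho' M M' a g : 0 < rho' -> rho' <= rho -> M <= M' ->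
  has_pseries rho M a g -> has_pseries rho' M' a g.
Proof.
move=> r0 rr MM [aM ag]; split=> [k|w wr]; last by apply: ag; exact: lt_le_trans rr.
apply: le_trans MM; apply: le_trans (aM k); rewrite ler_wpM2l ?cnorm_ge0 //.
by apply: lerXn2r => //; rewrite nnegrE ltW // (lt_le_trans r0).
Qed.

Lemma coef_le_geometric rho M a w k : 0 < rho ->
  cnorm (a k) * rho ^+ k <= M ->
  cnorm (a k * w ^+ k) <= M * (cnorm w / rho) ^+ k.
Proof.
move=> r0 aM; rewrite cnormM cnormX expr_div_n mulrA ler_pdivlMr ?exprn_gt0 //.
by rewrite mulrAC ler_wpM2r // exprn_ge0 ?cnorm_ge0.
Qed.

Lemma ratio_lt1 rho w : cnorm w < rho -> 0 <= cnorm w / rho < 1.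
Proof.
move=> wr; have r0 : 0 < rho by apply: le_lt_trans wr; exact: cnorm_ge0.
by rewrite divr_ge0 ?cnorm_ge0 ?(ltW r0) //= ltr_pdivrMr // mul1r.
Qed.

Lemma has_pseries_tail rho M a g w K : has_pseries rho M a g -> cnorm w < rho ->
  cnorm (g w - psum a w K) <= M * (cnorm w / rho) ^+ K / (1 - cnorm w / rho).
Proof.
move=> [aM ag] wr; have /andP[t0 t1] := ratio_lt1 wr.
have r0 : 0 < rho by apply: le_lt_trans wr; exact: cnorm_ge0.
have M0 := has_pseries_ge0 (conj aM ag).
apply: (cvg_cnorm_le (K := K) (ag w wr)) => L /subnKC <-.
move: (L - K)%N => {}L; set t := _ / _ in t0 t1 *.
(* Multiplied by [1 - t], the finite geometric sum telescopes to [t ^+ K * (1 - t ^+ L)], so the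
   induction on [L] needs no division. *)
suff : cnorm (psum a w (K + L) - psum a w K) * (1 - t) <= M * t ^+ K * (1 - t ^+ L).
  move=> H; rewrite ler_pdivlMr ?subr_gt0 //; apply: le_trans H _.
  rewrite ler_piMr ?mulr_ge0 ?exprn_ge0 //.
  by rewrite lerBlDr lerDl exprn_ge0.
elim: L => [|L IH]; first by rewrite addn0 subrr cnorm0 expr0 subrr mul0r mulr0.
rewrite addnS psumS addrAC.
apply: le_trans (ler_wpM2r _ (cnormD _ _)) _; first by rewrite subr_ge0 ltW.
have := coef_le_geometric w r0 (aM (K + L)%N); rewrite -/t => H.
rewrite mulrDl; apply: le_trans (lerD IH (ler_wpM2r _ H)) _.
  by rewrite subr_ge0 ltW.
by rewrite exprS exprD; lra.
Qed.

Lemma has_pseries_bound rho M a g w : has_pseries rho M a g -> 0 < rho ->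
  cnorm w <= rho / 2 -> cnorm (g w) <= 2 * M.
Proof.
move=> H r0 wr; have wr' : cnorm w < rho by lra.
have := has_pseries_tail 0 H wr'; rewrite psum0 subr0 expr0 mulr1 => /le_trans; apply.
have M0 := has_pseries_ge0 H.
have : cnorm w / rho <= 2^-1 by rewrite ler_pdivrMr // mulrC.
move=> tw; rewrite ler_pdivrMr; last lra.
nra.
Qed.

Lemma has_pseries_exists rho M b : 0 < rho ->
  (forall k, cnorm (b k) * rho ^+ k <= M) ->
  has_pseries rho M b (fun w => lim (psum b w @ \oo)).
Proof.
move=> r0 bM; split=> // w wr.
apply: (is_cvg_series_geometric_bound (ratio_lt1 wr)) => k.
exact: coef_le_geometric.
Qed.

(* Synthetic division by [w - c]: the coefficients of the quotient are
   [B k.+1], and [B 0] is the remainder. *)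
Lemma has_pseries_synthetic_div rho M M' a g c (B : nat -> C) : 0 < rho ->
  has_pseries rho M a g -> (forall k, B k = a k + c * B k.+1) ->
  (forall k, cnorm (B k.+1) * rho ^+ k <= M') ->
  exists2 q, has_pseries rho M' (B \o succn) q &
    forall w, cnorm w < rho -> g w = B 0%N + (w - c) * q w.
Proof.
move=> r0 [aM ag] BE BM; have H := has_pseries_exists r0 BM.
exists (fun w => lim (psum (B \o succn) w @ \oo)); first exact: H.
move=> w wr; set q := lim _.
have /andP[t0 t1] := ratio_lt1 wr.
have sE K : (w - c) * psum (B \o succn) w K = B K * w ^+ K - B 0%N + psum a w K.
  elim: K => [|K IH]; first by rewrite !psum0 mulr0 expr0 mulr1 subrr addr0.
  by rewrite !psumS mulrDr IH /= (BE K) exprS; ring.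
have B0 : (fun K => B K * w ^+ K) @ \oo --> (0 : C).
  rewrite -(cvg_shiftS (fun K => B K * w ^+ K)) /=.
  have g0 : geometric (M' * cnorm w) (cnorm w / rho) @ \oo --> (0 : R).
    by apply: cvg_geometric; rewrite ger0_norm.
  apply: cvg0_cnorm_le g0 => k /=.
  rewrite exprSr mulrA cnormM mulrAC ler_wpM2r ?cnorm_ge0 //.
  exact: (coef_le_geometric (a := B \o succn) w r0 (BM k)).
have c1 : (fun K => (w - c) * psum (B \o succn) w K) @ \oo --> (w - c) * q.
  by apply: cvgMl_tmp; have [_ /(_ w wr)] := H.
have c2 : (fun K => (w - c) * psum (B \o succn) w K) @ \oo --> 0 - B 0%N + g w.
  rewrite (_ : (fun K => _) = (fun K => B K * w ^+ K - B 0%N + psum a w K)).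
    by apply: cvgD (ag w wr); apply: cvgB B0 (cvg_cst _).
  by apply/funext => K; rewrite sE.
have -> : (w - c) * q = 0 - B 0%N + g w by exact: (cvg_unique _ c1 c2).
by ring.
Qed.

(** Synthetic division with the rescaled tails at [c], the sums of [a j * c ^+ (j - k)] over
    [j >= k]; the tail estimate with ratio at most one half bounds them by [2 * M / rho ^+ k]. The
    last conclusion identifies [q c] with the termwise derivative at [c]. *)
Lemma has_pseries_div rho M a g c : 0 < rho -> has_pseries rho M a g ->
  cnorm c <= rho / 2 ->
  exists b q, [/\ has_pseries rho (2 * M / rho) b q,
    forall w, cnorm w < rho -> g w = g c + (w - c) * q w &
    cnorm c <= rho / 4 ->
    psum (fun k => k.+1%:R * a k.+1) c @ \oo --> q c].
Proof.
move=> r0 H cr; have [aM ag] := H; have cr' : cnorm c < rho by lra.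
have M0 := has_pseries_ge0 H.
have tc : cnorm c / rho <= 2^-1 by rewrite ler_pdivrMr // mulrC.
(* At [c = 0] the quotient formula would divide by zero; the rescaled tail is then its leading term
   [a k]. *)
pose B k := if c == 0 then a k else (g c - psum a c k) / c ^+ k.
have g0 : c = 0 -> g c = a 0%N.
  move=> c0; rewrite c0 in cr' ag *.
  have h0 : psum a 0 @ \oo --> a 0%N.
    rewrite -(cvg_shiftS (psum a 0)) (_ : (fun _ => _) = (fun=> a 0%N)) ?cvg_cst //.
      exact: cvg_cst.
    apply/funext; elim=> [|k /= IH]; rewrite psumS; first by rewrite psum0 add0r mulr1.
    by rewrite IH expr0n mulr0 addr0.
  exact: (cvg_unique _ (ag 0 cr') h0).
have B0 : B 0%N = g c.
  rewrite /B; case: eqP => [c0|_]; first by rewrite g0.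
  by rewrite psum0 subr0 expr0 divr1.
have BE k : B k = a k + c * B k.+1.
  rewrite /B; case: eqVneq => [->|c0]; first by rewrite mul0r addr0.
  by rewrite psumS exprS; field; rewrite ?expf_neq0 ?c0.
have BM k : cnorm (B k) * rho ^+ k <= 2 * M.
  rewrite /B; case: eqVneq => [_|c0]; first by have := aM k; lra.
  rewrite cnormM cnormV cnormX.
  have c0' : 0 < cnorm c by rewrite cnorm_gt0.
  have := has_pseries_tail k H cr'; rewrite expr_div_n => h.
  rewrite mulrAC ler_pdivrMr ?exprn_gt0 // -ler_pdivlMr ?exprn_gt0 //.
  apply: le_trans h _; rewrite ler_pdivrMr; last lra.
  rewrite -[2 * M * _ / _]mulrA; set x := cnorm c ^+ k / rho ^+ k.
  have x0 : 0 <= x by rewrite divr_ge0 ?exprn_ge0 ?(ltW c0') ?(ltW r0).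
  have : 0 <= M * x by rewrite mulr_ge0.
  by rewrite -[2 * M * x]mulrA; set y := M * x; nra.
have BM' k : cnorm (B k.+1) * rho ^+ k <= 2 * M / rho.
  by rewrite ler_pdivlMr // -mulrA -exprSr.
have [q qP gq] := has_pseries_synthetic_div r0 H BE BM'.
exists (B \o succn), q; split=> //; first by move=> w; rewrite -B0; exact: gq.
move=> cr4; have qc := qP.2 c cr'.
have [c0|c0] := eqVneq c 0.
  rewrite c0 in qc *; suff -> : psum (fun k => k.+1%:R * a k.+1) 0 = psum (B \o succn) 0 by [].
  apply/funext => K; rewrite /psum; congr series; apply/funext => -[|k].
    by rewrite /B /= c0 eqxx mul1r.
  by rewrite !expr0n !mulr0.
(* Summation by parts: the quotient series at [c] and the termwise derivative differ by [K] times a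
   tail, divided by [c]. *)
have sE K : psum (B \o succn) c K * c =
    K%:R * (g c - psum a c K.+1) + psum (fun k => k.+1%:R * a k.+1) c K * c.
  elim: K => [|K IH]; first by rewrite !psum0 !mul0r add0r.
  rewrite (psumS (B \o succn)) mulrDl IH (psumS (fun k => k.+1%:R * a k.+1)).
  rewrite (psumS a _ K.+1) /= /B (negPf c0).
  by rewrite -natr1 exprS; field; rewrite ?expf_neq0 ?c0.
have -> : psum (fun k => k.+1%:R * a k.+1) c =
    (fun K => psum (B \o succn) c K - K%:R * (g c - psum a c K.+1) / c).
  apply/funext => K; apply: (mulIf c0); rewrite mulrBl divfK // sE; ring.
rewrite -[q c]subr0; apply: cvgB qc _; rewrite -[0 : C](mul0r c^-1); apply: cvgMr_tmp.
have gg : geometric (2 * M) (2^-1 : R) @ \oo --> (0 : R).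
  by apply: cvg_geometric; rewrite ger0_norm; lra.
apply: cvg0_cnorm_le gg => k; rewrite cnormM cnorm_nat /=.
(* With ratio at most [4^-1] the tail decays like the product of two factors [2^-1 ^+ k]: one
   absorbs the factor [k], the other tends to zero. *)
have t4 : cnorm c / rho <= 4^-1 by rewrite ler_pdivrMr // mulrC.
have t0 : 0 <= cnorm c / rho by rewrite divr_ge0 ?cnorm_ge0 ?ltW.
have := has_pseries_tail k.+1 H cr'; set t := _ / _ in tc t4 t0 *.
move=> h; apply: le_trans (ler_wpM2l _ h) _ => //.
have k2 : k%:R * (2^-1 : R) ^+ k <= 1.
  rewrite exprVn ler_pdivrMr ?exprn_gt0 // mul1r -natrX ler_nat.
  by rewrite ltnW // ltn_expl.
have tk : t ^+ k <= (2^-1) ^+ k * (2^-1) ^+ k.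
  rewrite -exprMn lerXn2r ?nnegrE //; lra.
rewrite mulrA ler_pdivrMr; last lra.
set s := _ ^+ k in k2 tk *.
have s0 : 0 <= s by rewrite exprn_ge0 // invr_ge0.
have kt : k%:R * t ^+ k <= s.
  by apply: le_trans (ler_wpM2l _ tk) _ => //; rewrite mulrA ler_piMl.
have kt0 : 0 <= k%:R * t ^+ k by rewrite mulr_ge0 // exprn_ge0.
rewrite exprS mulrCA [_ * (t * _)]mulrCA; set y := k%:R * _ in kt kt0 *.
have : M * (t * y) <= M * s by rewrite ler_wpM2l //; nra.
have : 0 <= M * s by rewrite mulr_ge0.
set Ms := M * s => p1 p2; rewrite -/Ms -[2 * M * s]mulrA -/Ms; nra.
Qed.

(** The zero of [w - c] lies outside the disc, so the remainder [v] can be prescribed freely, and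
    the recursion for the coefficients is solved upwards from [v] instead of through tails. *)
Lemma has_pseries_div_far rho M a g c v : 0 < rho -> has_pseries rho M a g ->
  2 * rho <= cnorm c -> cnorm v <= 2 * M ->
  exists b q, has_pseries rho (3 * M / rho) b q /\
    forall w, cnorm w < rho -> g w = v + (w - c) * q w.
Proof.
move=> r0 H cr vM; have M0 := has_pseries_ge0 H; have [aM _] := H.
have c0' : 0 < cnorm c by lra.
have c0 : c != 0 by rewrite -cnorm_gt0.
pose B := fix B k := if k is k'.+1 then (B k' - a k') / c else v.
have BE k : B k = a k + c * B k.+1 by rewrite /=; field; rewrite ?expf_neq0 ?c0.
suff BM : forall k, cnorm (B k.+1) * rho ^+ k <= 3 * M / rho.
  have [q qP gq] := has_pseries_synthetic_div r0 H BE BM.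
  by exists (B \o succn), q.
(* Since [2 * rho <= cnorm c], the recursion gives [(5 * M + M) / cnorm c <= 3 * M / rho];
   multiplied by [rho] this is at most [5 * M] again, and the start [2 * M] is below it too. *)
have st k : cnorm (B k) * rho ^+ k <= 5 * M ->
    cnorm (B k.+1) * rho ^+ k <= 3 * M / rho.
  move=> h; rewrite /= cnormM cnormV mulrAC ler_pdivrMr //.
  have ax := aM k; set x := rho ^+ k in h ax *.
  have x0 : 0 <= x by rewrite exprn_ge0 // ltW.
  apply: le_trans (ler_wpM2r x0 (cnormB _ _)) _.
  have : 6 * M <= 3 * M / rho * cnorm c.
    rewrite mulrAC ler_pdivlMr //; nra.
  lra.
elim=> [|k IH]; apply: st; first by rewrite /= expr0 mulr1; lra.
by rewrite exprSr mulrA -ler_pdivlMr // (le_trans IH) // ler_pM2r ?invr_gt0 //; lra.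
Qed.

Lemma has_pseries_sub rho M M' a b g h : has_pseries rho M a g -> has_pseries rho M' b h ->
  0 < rho -> has_pseries rho (M + M') (fun k => a k - b k) (fun w => g w - h w).
Proof.
move=> [aM ag] [bM bh] r0; split=> [k|w wr].
  apply: le_trans (lerD (aM k) (bM k)); rewrite -mulrDl.
  by rewrite ler_wpM2r ?cnormB // exprn_ge0 // ltW.
rewrite (_ : psum _ w = (fun K => psum a w K - psum b w K)).
  exact: cvgB (ag w wr) (bh w wr).
apply/funext; elim=> [|K IH]; first by rewrite !psum0 subrr.
by rewrite !psumS IH; ring.
Qed.

Lemma has_pseries_poly rho (p : {poly C}) z : 0 < rho ->
  exists M, has_pseries rho M (fun k => p^`N(k).[z]) (fun w => p.[z + w]).
Proof.
move=> r0; exists (\sum_(k < size p) cnorm p^`N(k).[z] * rho ^+ k); split.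
  move=> k; case: (ltnP k (size p)) => kp.
    rewrite (bigD1 (Ordinal kp)) //= lerDl sumr_ge0 // => i _.
    by rewrite mulr_ge0 ?cnorm_ge0 // exprn_ge0 // ltW.
  rewrite nderivn_poly0 // horner0 cnorm0 mul0r sumr_ge0 // => i _.
  by rewrite mulr_ge0 ?cnorm_ge0 // exprn_ge0 // ltW.
move=> w _; apply: (@cvg_near_cst); exists (size p) => // K /= pK.
rewrite (nderiv_taylor_wide (mulrC _ _) pK) /psum /series /=.
by rewrite big_mkord.
Qed.

(** Once the lower coefficients vanish, [d j * w ^+ j] is [g w] minus a tail, both of order [j.+1]
    at 0; dividing by [w ^+ j] and letting [w] tend to 0 forces [d j = 0]. *)
Lemma has_pseries_coef0 rho M d g (B r : R) (m j : nat) : 0 < rho -> 0 < r ->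
  has_pseries rho M d g ->
  (forall w, cnorm w < r -> cnorm (g w) <= B * cnorm w ^+ m) ->
  (j < m)%N -> d j = 0.
Proof.
move=> r0 rr0 H gB; elim/ltn_ind: j => j IH jm.
have M0 := has_pseries_ge0 H.
apply/eqP; rewrite -cnorm_eq0 eq_le cnorm_ge0 andbT.
have sE w : psum d w j.+1 = d j * w ^+ j.
  rewrite psumS; suff -> : psum d w j = 0 by rewrite add0r.
  rewrite /psum /series /= big_nat_cond big1 // => i.
  by rewrite andbT => /andP[_ ij]; rewrite IH ?mul0r // (ltn_trans ij).
have B0 : 0 <= B.
  have := gB (r / 2)%:C; rewrite cnorm_real ger0_norm; last lra.
  move=> /(_ _)/(le_trans (cnorm_ge0 _)); rewrite pmulr_lge0; last by rewrite exprn_gt0 //; lra.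
  by apply; lra.
pose D := B + 2 * M / rho ^+ j.+1.
have D0 : 0 <= D by rewrite addr_ge0 // divr_ge0 ?mulr_ge0 // exprn_ge0 // ltW.
apply/ler_addgt0Pr => e e0; rewrite add0r.
(* In turn: the ratio [x / rho] is at most one half, the hypothesis on [g] applies,
   [x ^+ m <= x ^+ j.+1], and [D * x <= e]. *)
pose x := Num.min (Num.min (rho / 2) (r / 2)) (Num.min 1 (e / (D + 1))).
have x0 : 0 < x by rewrite !lt_min ltr01 divr_gt0 //= ?divr_gt0 //; lra.
have [x1 x2 x3 x4] : [/\ x <= rho / 2, x <= r / 2, x <= 1 & x <= e / (D + 1)].
  by split; rewrite !ge_min lexx ?orbT.
have xN : cnorm x%:C = x by rewrite cnorm_real gtr0_norm.
have h1 := gB x%:C; rewrite xN in h1.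
have h2 := has_pseries_tail (w := x%:C) j.+1 H; rewrite xN sE in h2.
have {}h1 : cnorm (g x%:C) <= B * x ^+ m by apply: h1; lra.
have {}h2 := h2 _; have xr : x < rho by lra.
have {xr}h2 := h2 xr.
have tx : x / rho <= 2^-1 by rewrite ler_pdivrMr // mulrC.
have h3 : M * (x / rho) ^+ j.+1 / (1 - x / rho) <= 2 * M / rho ^+ j.+1 * x ^+ j.+1.
  rewrite expr_div_n ler_pdivrMr; last lra.
  set y := x ^+ _ / _; have y0 : 0 <= y by rewrite divr_ge0 // exprn_ge0 // ltW.
  have -> : 2 * M / rho ^+ j.+1 * x ^+ j.+1 = 2 * (M * y) by rewrite /y; ring.
  have : 0 <= M * y by rewrite mulr_ge0.
  by set My := M * y; nra.
have h4 : B * x ^+ m <= B * x ^+ j.+1.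
  by rewrite ler_wpM2l // ler_wiXn2l // ltW.
have h5 : cnorm (d j) * x ^+ j <= D * x ^+ j.+1.
  have := cnorm_subD (d j * x%:C ^+ j) (g x%:C).
  rewrite cnorm_distC cnormM cnormX xN /D mulrDl; lra.
have {}h5 : cnorm (d j) <= D * x.
  by rewrite -(ler_pM2r (exprn_gt0 j x0)) -mulrA -exprS.
apply: le_trans h5 _; have : (D + 1) * x <= e by rewrite mulrC -ler_pdivlMr //; lra.
nra.
Qed.

End BoundedPowerSeries.

(** * Analytic functions and Newton interpolation *)

Section AnalyticFunctions.
Variable R : realType.
Local Notation C := R[i].
Implicit Types (a b d : nat -> C) (f g : C -> C) (z w c : C) (rho M : R).

(** Dividing twice by [w - c] gives [f (z + c + h) = f (z + c) + h * (q c + h * q2 (c + h))] with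
    [q2] bounded, so the difference quotient tends to [q c], the termwise derivative. The radius
    [rho / 4] serves both that identification and the estimate of [k.+1] by [4 ^+ k]. *)
Lemma has_pseries_derive rho M a f z : 0 < rho ->
  has_pseries rho M a (fun w => f (z + w)) ->
  has_pseries (rho / 4) (2 * M / rho) (fun k => k.+1%:R * a k.+1)
    (fun w => f^`()%classic (z + w)).
Proof.
move=> r0 H; have M0 := has_pseries_ge0 H; split=> [k|c cr].
  have [/(_ k.+1) + _] := H; rewrite cnormM cnorm_nat exprS expr_div_n.
  have k4 : k.+1%:R / 4 ^+ k <= (1 : R).
    rewrite ler_pdivrMr ?exprn_gt0 // mul1r -natrX ler_nat.
    exact: ltn_expl.
  set x := rho ^+ k; set y := cnorm _ => yx.
  have x0 : 0 < x by rewrite exprn_gt0.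
  have y0 : 0 <= y := cnorm_ge0 _.
  have -> : k.+1%:R * y * (x / 4 ^+ k) = k.+1%:R / 4 ^+ k * (y * x) by ring.
  apply: le_trans (ler_wpM2r _ k4) _; first by rewrite mulr_ge0 // ltW.
  rewrite mul1r ler_pdivlMr //; nra.
have c2 : cnorm c <= rho / 2 by have := cnorm_ge0 c; lra.
have [b [q [qP gq /(_ (ltW cr)) qc]]] := has_pseries_div r0 H c2.
have [b2 [q2 [q2P qq _]]] := has_pseries_div r0 qP c2.
suff -> : f^`()%classic (z + c) = q c by [].
apply: cvg_lim => //; apply/cvg_cnormP.
set K := 2 * (2 * (2 * M / rho) / rho).
have hK : (fun h : C => K * cnorm h) @ 0^' --> (0 : R).
  rewrite -(mulr0 K); apply: cvgMl_tmp.
  have : (fun h : C => h) @ 0^' --> (0 : C) by exact: cvg_within.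
  move/cvg_cnormP; rewrite (_ : (fun k : C => _) = @cnorm R) //.
  by apply/funext => h; rewrite subr0.
apply: squeeze_cvgr (cvg_cst 0) hK; near=> h.
have h0 : h != 0 by near: h; exact: nbhs_dnbhs_neq.
have hr : cnorm h < rho / 4.
  near: h; apply: nbhs_dnbhs; apply/nbhs_cnormP; exists (rho / 4); first lra.
  by move=> h; rewrite subr0.
have wr : cnorm (c + h) <= rho / 2 by have := cnormD c h; lra.
have wr' : cnorm (c + h) < rho by lra.
rewrite cnorm_ge0 /=.
have -> : f (h + (z + c)) = f (z + c) + h * (q c + h * q2 (c + h)).
  have -> : h + (z + c) = z + (c + h) by ring.
  by rewrite gq // qq //; ring.
have -> (x y : C) : h^-1 *: (x + h * (q c + h * y) - x) - q c = h * y.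
  by rewrite -[_ *: _]/(_ * _); field.
rewrite cnormM mulrC ler_wpM2r ?cnorm_ge0 //.
exact: has_pseries_bound q2P r0 wr.
Unshelve. all: by end_near. Qed.

Lemma derive1n_has_pseries rho M a f z j : 0 < rho ->
  has_pseries rho M a (fun w => f (z + w)) -> f^`(j)%classic z = j`!%:R * a j.
Proof.
elim: j rho M a f => [|j IH] rho M a f r0 H.
  rewrite derive1n0 mul1r.
  have c0 : (cnorm (0 : C) < rho) by rewrite cnorm0.
  have := has_pseries_tail 1 H c0; rewrite psumS psum0 addr0 add0r expr0 mulr1.
  rewrite cnorm0 mul0r expr1 mulr0 mul0r => h; apply/eqP; rewrite -subr_eq0.
  by rewrite -cnorm_eq0 eq_le h cnorm_ge0.
rewrite derive1Sn (IH _ _ _ _ _ (has_pseries_derive r0 H)); last lra.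
by rewrite factS natrM; ring.
Qed.

(** Convergence at the single point [r / 2] bounds all terms there: beyond [K] a term is the
    difference of two partial sums within 1 of the limit, hence at most 2, and the earlier terms are
    bounded by their sum. *)
Lemma analytic_has_pseries (D : set C) f z : analytic_on D f -> D z ->
  exists a rho M, 0 < rho /\ has_pseries rho M a (fun w => f (z + w)).
Proof.
move=> fD /fD [a /nbhs_cnormP [r r0 H]]; exists a, (r / 2).
have H' w : cnorm w < r -> psum a w @ \oo --> f (z + w).
  by move=> wr; have := H (z + w); rewrite [z + w]addrC addrK; apply.
have := H' (r / 2)%:C; rewrite cnorm_real ger0_norm; last lra.
move=> /(_ _) /cvg_cnormP /cvgrPdist_lt /(_ 1 ltr01) [|K _ KP]; first lra.
exists (\sum_(k < K) cnorm (a k) * (r / 2) ^+ k + 2); split; first lra.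
split=> [k|w wr]; last by apply: H'; lra.
have sum0 (P : pred 'I_K) : 0 <= \sum_(k < K | P k) cnorm (a k) * (r / 2) ^+ k.
  by apply: sumr_ge0 => i _; rewrite mulr_ge0 ?cnorm_ge0 // exprn_ge0 //; lra.
case: (ltnP k K) => kK.
  by rewrite (bigD1 (Ordinal kK)) //= -addrA lerDl addr_ge0.
have := KP k kK; have := KP k.+1 (leqW kK); rewrite /= !sub0r !normrN.
rewrite !(ger0_norm (cnorm_ge0 _)) psumS; set x := psum _ _ _; set F := f _.
have -> : cnorm (a k) * (r / 2) ^+ k = cnorm (a k * (r / 2)%:C ^+ k).
  by rewrite cnormM cnormX cnorm_real ger0_norm //; lra.
set y := a k * _ => h1 h2.
have := cnormB (x + y - F) (x - F); have -> : x + y - F - (x - F) = y by ring.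
have := sum0 predT; lra.
Qed.

End AnalyticFunctions.

(** * Newton interpolation on a union of separated discs *)

Section NewtonInterpolation.
Variables (R : realType) (Lambda : seq R[i]) (rho : R).
Local Notation C := R[i].
Hypothesis rho_gt0 : 0 < rho.
Hypothesis Lambda_sep : {in Lambda &, forall x y : C, x != y -> 3 * rho <= cnorm (x - y)}.
Implicit Types (G : C -> C -> C) (M : R) (mu : C) (s : seq C).

(* [G x w] stands for the value at [x + w] of a function defined on the union of
   the discs of radius [rho] centered at [Lambda]. *)
Definition pseries_family M G : Prop :=
  {in Lambda, forall x, exists a, has_pseries rho M a (G x)}.

Definition near_centers mu : Prop := exists2 x : C, x \in Lambda & cnorm (mu - x) <= rho / 2.

(** One Newton step on all discs at once. The value [v] at [mu] comes from the disc that contains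
    [mu]; on the others [mu] is far away, and division with the prescribed remainder [v] applies. *)
Lemma pseries_family_div M G mu : pseries_family M G -> near_centers mu ->
  exists v G', [/\ cnorm v <= 2 * M, pseries_family (3 * M / rho) G' &
    {in Lambda, forall x w, cnorm w < rho -> G x w = v + (x + w - mu) * G' x w}].
Proof.
move=> GM [x0 x0L mux0]; have [a0 Ga0] := GM _ x0L.
have M0 := has_pseries_ge0 Ga0.
have [b [q [qP Gq _]]] := has_pseries_div rho_gt0 Ga0 mux0.
have vM := has_pseries_bound Ga0 rho_gt0 mux0.
set v := G x0 _ in vM Gq.
have /choice[G' G'P] : forall x, exists h : C -> C, x \in Lambda ->
    (exists b, has_pseries rho (3 * M / rho) b h) /\
    forall w, cnorm w < rho -> G x w = v + (x + w - mu) * h w.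
  move=> x; have [xL|] := boolP (x \in Lambda); last by exists (fun=> 0).
  have [->|xx0] := eqVneq x x0.
    exists q => _; split; last by move=> w /Gq ->; congr (_ + _ * _); ring.
    exists b; apply: has_pseries_weaken qP => //.
    by rewrite ler_pM2r ?invr_gt0 // ler_wpM2r // ler_nat.
  have [a Ga] := GM _ xL.
  (* Separation [3 * rho] of the centers minus the distance [rho / 2] from [mu] to its own
     center. *)
  have far : 2 * rho <= cnorm (mu - x).
    have h2 : 3 * rho <= cnorm (x0 - x) by apply: Lambda_sep; rewrite // eq_sym.
    have h3 : cnorm (x0 - x) <= cnorm (mu - x) + cnorm (mu - x0).
      by have -> : x0 - x = mu - x - (mu - x0); [ring | exact: cnormB].
    move: h2 h3 mux0 rho_gt0.
    move: (cnorm (mu - x)) (cnorm (mu - x0)) (cnorm (x0 - x)) => A1 A2 A3. lra.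
  have [b' [h [hP Gh]]] := has_pseries_div_far rho_gt0 Ga far vM.
  exists h => _; split; first by exists b'.
  by move=> w /Gh ->; congr (_ + _ * _); ring.
exists v, G'; split; first exact: vM.
  by move=> x xL; case: (G'P x xL).
by move=> x xL; case: (G'P x xL).
Qed.

(** The point is the order of quantifiers: [B] depends on the number of nodes, the centers and
    [rho], but neither on the function nor on the position of the nodes. Repeated nodes are
    allowed. *)
Lemma newton_interpolation N : exists2 B : R, 0 <= B &
  forall M G s, size s = N -> pseries_family M G -> {in s, forall mu, near_centers mu} ->
  exists (p : {poly C}) G', [/\ (size p <= N)%N, forall k, cnorm p`_k <= B * M,
    exists M', pseries_family M' G' &
    {in Lambda, forall x w, cnorm w < rho ->
      G x w = p.[x + w] + (\prod_(mu <- s) ('X - mu%:P)).[x + w] * G' x w}].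
Proof.
elim: N => [|N [B B0 IH]].
  exists 0 => // M G [] // _ GM _; exists 0, G; split=> //.
  - by rewrite size_poly0.
  - by move=> k; rewrite coef0 cnorm0 mul0r.
  - by exists M.
  - by move=> x xL w wr; rewrite big_nil !hornerE; ring.
pose L := \sum_(x <- Lambda) cnorm x + rho.
have LP mu : near_centers mu -> cnorm mu <= L.
  move=> [x xL mx]; have := cnormD (mu - x) x; rewrite subrK => /le_trans; apply.
  rewrite /L (big_rem x) //=; set S := \sum_(_ <- _) _.
  have : 0 <= S by apply: sumr_ge0 => *; exact: cnorm_ge0.
  by have := rho_gt0; lra.
have L0 : 0 <= L by rewrite addr_ge0 ?(ltW rho_gt0) // sumr_ge0 // => *; exact: cnorm_ge0.
(* For the new polynomial [v%:P + ('X - mu%:P) * p]: [v] contributes [2 * M], and the factor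
   ['X - mu%:P] multiplies by at most [1 + L] the inductive bound taken at [3 * M / rho]. *)
exists (2 + (1 + L) * (B * 3 / rho)).
  have B3 : 0 <= B * 3 / rho by apply: divr_ge0; [exact: mulr_ge0 | exact: ltW].
  by apply: addr_ge0 => //; apply: mulr_ge0 => //; exact: addr_ge0.
move=> M G [//|mu s] [sN] GM smu.
have muc : near_centers mu by apply: smu; rewrite mem_head.
have [v [G1 [vM G1M GG1]]] := pseries_family_div GM muc.
have [|p [G2 [pN pB G2M G1G2]]] := IH _ _ s sN G1M.
  by move=> x xs; apply: smu; rewrite inE xs orbT.
exists (v%:P + ('X - mu%:P) * p), G2; split; last first.
- by move=> x xL w wr; rewrite GG1 // G1G2 // big_cons !hornerE; ring.
- exact: G2M.
- move=> k; rewrite coefD coefC mulrBl coefB coefXM coefCM.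
  have cB j : cnorm (if j == 0%N then v else 0) <= 2 * M.
    case: ifP => // _; rewrite cnorm0; exact: le_trans (cnorm_ge0 _) vM.
  have pk : cnorm (if k == 0%N then 0 else p`_k.-1) <= B * (3 * M / rho).
    by case: ifP => // _; rewrite cnorm0; exact: le_trans (cnorm_ge0 _) (pB 0%N).
  have mp : cnorm (mu * p`_k) <= L * (B * (3 * M / rho)).
    by rewrite cnormM ler_pM ?cnorm_ge0 // LP.
  apply: le_trans (cnormD _ _) _; apply: le_trans (lerD (cB k) (cnormB _ _)) _.
  have -> : (2 + (1 + L) * (B * 3 / rho)) * M =
    2 * M + (B * (3 * M / rho) + L * (B * (3 * M / rho))) by ring.
  by rewrite lerD2l lerD.
- rewrite (leq_trans (size_polyD _ _)) // geq_max (leq_trans (size_polyC_leq1 _)) //=.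
  by rewrite (leq_trans (size_polyMleq _ _)) // size_XsubC addSn add1n ltnS.
Qed.

End NewtonInterpolation.

(** * Matrix functions as interpolating polynomials *)

Section HermiteInterpolation.
Variable F : fieldType.
Implicit Types (p q s : {poly F}) (x : F).

(** One derivative of [('X - x%:P) ^+ m.+1 * s] is [('X - x%:P) ^+ m] times a polynomial whose value
    at [x] is [s.[x] *+ m.+1]; iterating builds the factorial. *)
Lemma derivn_XsubC_exp_mul x m s j : (j <= m)%N ->
  (('X - x%:P) ^+ m * s)^`(j).[x] = (s.[x] *+ m`!) *+ (j == m).
Proof.
elim: m s j => [|m IH] s j.
  by rewrite leqn0 => /eqP ->; rewrite mul1r.
case: j => [|j] jm; first by rewrite derivn0 exprS !hornerE subrr !mul0r.
have -> : (('X - x%:P) ^+ m.+1 * s)^`(j.+1) =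
    (('X - x%:P) ^+ m * (s *+ m.+1 + ('X - x%:P) * s^`()))^`(j).
  rewrite derivSn derivM deriv_exp derivXsubC mul1r /= mulrDr mulrnAl mulrnAr.
  by rewrite exprSr mulrA.
rewrite IH // !hornerE subrr mul0r addr0 hornerMn eqSS.
by rewrite factS mulrnA.
Qed.

Lemma derivn_dvdp_eq0 x m p j : ('X - x%:P) ^+ m %| p -> (j < m)%N -> p^`(j).[x] = 0.
Proof.
move=> /dvdpP[s ->] jm; rewrite mulrC derivn_XsubC_exp_mul 1?ltnW //.
by rewrite ltn_eqF.
Qed.

Lemma dvdp_derivn_eq0 x m p : [pchar F] =i pred0 ->
  (forall j, (j < m)%N -> p^`(j).[x] = 0) -> ('X - x%:P) ^+ m %| p.
Proof.
move=> /pcharf0P ch; elim: m => [|m IH] H; first by rewrite expr0 dvd1p.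
have /dvdpP[s sE] : ('X - x%:P) ^+ m %| p by apply: IH => j jm; apply: H; exact: ltnW.
have := H m (ltnSn m); rewrite sE mulrC derivn_XsubC_exp_mul // eqxx mulr1n.
move=> /eqP; rewrite -mulr_natr mulf_eq0 ch -leqn0 leqNgt fact_gt0 orbF.
by rewrite exprSr dvdp_mul2l ?expf_neq0 ?polyXsubC_eq0 // dvdp_XsubCl.
Qed.

End HermiteInterpolation.

Lemma mup_prod_XsubC (F : fieldType) (s : seq F) x :
  mup x (\prod_(z <- s) ('X - z%:P)) = count_mem x s.
Proof.
elim: s => [|z s IH]; first by rewrite big_nil mupNroot // rootC oner_eq0.
rewrite big_cons mupM ?polyXsubC_eq0 ?IH //; last first.
  by rewrite monic_neq0 // monic_prod_XsubC.
by rewrite -['X - _]expr1 mup_XsubCX /=; case: eqP.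
Qed.

Lemma dvdp_prod_XsubC (F : fieldType) (s : seq F) (p : {poly F}) : p != 0 ->
  (forall x, count_mem x s <= mup x p)%N -> \prod_(z <- s) ('X - z%:P) %| p.
Proof.
elim: s p => [|z s IH] p p0 sp; first by rewrite big_nil dvd1p.
have : root p z.
  rewrite -dvdp_XsubCl -['X - _]expr1 -mup_geq //.
  by apply: leq_trans (sp z); rewrite /= eqxx.
move=> /factor_theorem[p' pE]; move: p0 sp; rewrite pE mulf_eq0 polyXsubC_eq0 orbF.
move=> p0 sp; rewrite big_cons mulrC dvdp_mul2r ?polyXsubC_eq0 //.
apply: IH => // x; have := sp x; rewrite mupM ?polyXsubC_eq0 //= -['X - _]expr1.
by rewrite mup_XsubCX; case: eqP => _; rewrite ?add1n ?addn1 ?addn0 ?add0n.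
Qed.

Lemma dvdp_derivn (F : closedFieldType) (p q : {poly F}) : [pchar F] =i pred0 ->
  q \is monic ->
  (forall x, root q x -> forall j, (j < mup x q)%N -> p^`(j).[x] = 0) -> q %| p.
Proof.
move=> ch qm H; have [->|p0] := eqVneq p 0; first exact: dvdp0.
have [s sE] := closed_field_poly_normal q.
rewrite (monicP qm) scale1r in sE; rewrite sE; apply: dvdp_prod_XsubC => // x.
rewrite -mup_prod_XsubC -sE; have [qx|/mupNroot -> //] := boolP (root q x).
by rewrite mup_geq //; apply: dvdp_derivn_eq0 => //; exact: H.
Qed.

(** * Matrix functions evaluated through polynomials with matching Hermite data *)

Section MatrixFunction.
Variable R : realType.
Local Notation C := R[i].

(** Reduction modulo the minimal polynomial changes neither the Hermite data nor the value at [A],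
    so [p %% psi] is an interpolant and the default of [xget] is not reached. The chosen interpolant
    has the same data as [p], hence their difference is divisible by [psi] and vanishes at [A]. *)
Lemma mxfun_interp n (f : C -> C) (A : 'M[C]_n.+1) (p : {poly C}) :
  (forall x, spectrum A x -> forall j, (j < mup x (mxminpoly A))%N ->
    p^`(j).[x] = f^`(j)%classic x) ->
  mxfun f A = horner_mx A p.
Proof.
move=> H; set psi := mxminpoly A in H *.
have psi0 : psi != 0 by rewrite monic_neq0 ?mxminpoly_monic.
have mA x (r : {poly C}) j : (j < mup x psi)%N -> psi %| r -> r^`(j).[x] = 0.
  move=> jm pr; apply: (@derivn_dvdp_eq0 _ _ (mup x psi)) jm.
  by apply: dvdp_trans pr; rewrite -mup_geq.
have p0H : hermite_interp f A (p %% psi).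
  split; first by rewrite ltn_modp.
  move=> x Ax j jm; rewrite -H //; apply/eqP.
  rewrite eq_sym -subr_eq0 -hornerN -hornerD -derivnN -derivnD.
  by apply/eqP/mA => //; rewrite {1}(divp_eq p psi) addrK dvdp_mull.
rewrite /mxfun; case: xgetP => [p1 p1E [_ p1H]|]; last by move=> /(_ (p %% psi)).
apply/eqP; rewrite -subr_eq0 -rmorphB /= -dvd_mxminpoly; apply: dvdp_derivn.
- exact: pchar_num.
- exact: mxminpoly_monic.
- move=> x; rewrite -eigenvalue_root_min => Ax j jm.
  by rewrite derivnB !hornerE p1H // H // subrr.
Qed.

(** At an eigenvalue of multiplicity [m] in the minimal polynomial, [q] vanishes to order [m] and
    [g] is bounded, so [f - p] is of order [m] and its Taylor coefficients below [m] are zero. *)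
Lemma mxfun_interp_near n (f : C -> C) (A : 'M[C]_n.+1) (p q : {poly C}) :
  mxminpoly A %| q ->
  (forall x, spectrum A x -> exists a rho M B (g : C -> C), [/\ 0 < rho,
    has_pseries rho M a (fun w => f (x + w)) &
    forall w, cnorm w < rho ->
      f (x + w) = p.[x + w] + q.[x + w] * g w /\ cnorm (g w) <= B]) ->
  mxfun f A = horner_mx A p.
Proof.
move=> Aq H; apply: mxfun_interp => x /H [a [rho [M [B [g [r0 fa fK]]]]]] j jm.
rewrite (derive1n_has_pseries j r0 fa) nderivn_def hornerMn -mulr_natl.
congr (_ * _); apply/esym/eqP; rewrite -subr_eq0; apply/eqP.
have [M' pM'] := has_pseries_poly p x r0.
set m := mup x _ in jm.
have /dvdpP[r rE] : ('X - x%:P) ^+ m %| q.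
  by apply: dvdp_trans Aq; rewrite -mup_geq // monic_neq0 // mxminpoly_monic.
have [Mr rM] := has_pseries_poly r x r0.
have r2 : 0 < rho / 2 by lra.
apply: (has_pseries_coef0 (B := 2 * Mr * B) r0 r2 (has_pseries_sub fa pM' r0) _ jm).
move=> w wr; have [|-> KB] := fK w; first by lra.
rewrite addrAC subrr add0r rE !hornerE /= [x + w]addrC addrK -mulrA !cnormM cnormX.
have rB : cnorm r.[w + x] <= 2 * Mr.
  by rewrite addrC; apply: has_pseries_bound rM r0 _; exact: ltW.
have h := ler_wpM2r (exprn_ge0 m (cnorm_ge0 w))
  (ler_pM (cnorm_ge0 _) (cnorm_ge0 _) rB KB).
by rewrite [2 * Mr * _]mulrA mulrAC.
Qed.

End MatrixFunction.

(** * Norm estimates for matrix polynomials *)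

Section MatrixNorm.
Variable R : realType.
Local Notation C := R[i].

(** The largest modulus of an entry, with values in [R]. It is not submultiplicative, whence the
    dimension factors in the product estimates. *)
Definition mxnorm m n (A : 'M[C]_(m, n)) : R := complex.Re `|A|.

Lemma mxnormE m n (A : 'M[C]_(m, n)) : `|A| = (mxnorm A)%:C.
Proof. by rewrite /mxnorm RRe_real // normr_real. Qed.

Lemma mxnorm_ge0 m n (A : 'M[C]_(m, n)) : 0 <= mxnorm A.
Proof. by rewrite -ler0c -mxnormE normr_ge0. Qed.

Lemma mxnorm0 m n : mxnorm (0 : 'M[C]_(m, n)) = 0.
Proof. by apply: complexI; rewrite -mxnormE normr0. Qed.

Lemma mxnorm_gt0 m n (A : 'M[C]_(m, n)) : (0 < mxnorm A) = (A != 0).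
Proof. by rewrite -ltcR -mxnormE normr_gt0. Qed.

Lemma mxnormD m n (A B : 'M[C]_(m, n)) : mxnorm (A + B) <= mxnorm A + mxnorm B.
Proof. by rewrite -lecR rmorphD /= -!mxnormE ler_normD. Qed.

Lemma mxnormN m n (A : 'M[C]_(m, n)) : mxnorm (- A) = mxnorm A.
Proof. by apply: complexI; rewrite -!mxnormE normrN. Qed.

Lemma mxnormZ m n a (A : 'M[C]_(m, n)) : mxnorm (a *: A) = cnorm a * mxnorm A.
Proof. by apply: complexI; rewrite rmorphM /= -!mxnormE normrZ cnormE. Qed.

Lemma mxnorm_sum I (r : seq I) (P : pred I) m n (F : I -> 'M[C]_(m, n)) :
  mxnorm (\sum_(i <- r | P i) F i) <= \sum_(i <- r | P i) mxnorm (F i).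
Proof.
elim/big_ind2: _ => [|x1 x2 y1 y2 h1 h2|//]; first by rewrite mxnorm0.
by rewrite (le_trans (mxnormD _ _)) // lerD.
Qed.

Lemma cnorm_entry m n (A : 'M[C]_(m, n)) i j : cnorm (A i j) <= mxnorm A.
Proof.
rewrite -lecR -cnormE -mxnormE -[`|A|]/(mx_norm A) mx_normE.
rewrite -[X in X <= _]/(`|A (i, j).1 (i, j).2|) -[leLHS]nngE num_le.
exact: le_bigmax.
Qed.

Lemma mxnorm_le m n (A : 'M[C]_(m, n)) (c : R) : 0 <= c ->
  (forall i j, cnorm (A i j) <= c) -> mxnorm A <= c.
Proof.
move=> c0 Ac; have [->|A0] := eqVneq A 0; first by rewrite mxnorm0.
have : mx_norm A != 0 by rewrite -[mx_norm A]/(`|A|) normr_eq0.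
move=> /mx_norm_neq0[ij E]; rewrite -lecR -mxnormE -[`|A|]/(mx_norm A) E cnormE lecR.
exact: Ac.
Qed.

Lemma mxnormM m n p (A : 'M[C]_(m, n)) (B : 'M[C]_(n, p)) :
  mxnorm (A *m B) <= n%:R * (mxnorm A * mxnorm B).
Proof.
have AB0 : 0 <= mxnorm A * mxnorm B by rewrite mulr_ge0 ?mxnorm_ge0.
apply: mxnorm_le => [|i j]; first by rewrite mulr_ge0.
rewrite mxE; apply: le_trans (cnorm_sum _ _ _) _.
apply: le_trans (ler_sum (G := fun=> mxnorm A * mxnorm B) _ _) _.
  by move=> k _; rewrite cnormM ler_pM ?cnorm_ge0 ?cnorm_entry.
by rewrite sumr_const card_ord mulr_natl.
Qed.

Lemma mxnorm_mulr n (A B : 'M[C]_n.+1) :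
  mxnorm (A * B) <= n.+1%:R * (mxnorm A * mxnorm B).
Proof. exact: mxnormM. Qed.

Lemma mxnorm1 n : mxnorm (1 : 'M[C]_n.+1) <= 1.
Proof.
apply: mxnorm_le => // i j; rewrite mxE; case: eqP => _.
  by rewrite mulr1n cnorm1.
by rewrite mulr0n cnorm0.
Qed.

Lemma mxnormX n (A : 'M[C]_n.+1) k : mxnorm (A ^+ k) <= (n.+1%:R * mxnorm A) ^+ k.
Proof.
elim: k => [|k IH]; first by rewrite !expr0 mxnorm1.
rewrite !exprS; apply: le_trans (mxnorm_mulr _ _) _.
by rewrite -mulrA !ler_wpM2l ?mxnorm_ge0.
Qed.

Lemma nbhs_mxnormP m n (A : 'M[C]_(m, n)) (P : set 'M[C]_(m, n)) :
  (\forall B \near A, P B) <->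
  exists2 r : R, 0 < r & forall B, mxnorm (B - A) < r -> P B.
Proof.
split=> [|[r r0 H]].
  move/nbhs_ballP => [e /= /gt0_complexE [d d0 ->] H]; exists d => // B Bd.
  by apply: H; rewrite mx_norm_ball /ball_ /= mxnormE ltcR -opprB mxnormN.
apply/nbhs_ballP; exists r%:C => /=; first by rewrite ltcR.
by move=> B; rewrite mx_norm_ball /ball_ /= mxnormE ltcR -opprB mxnormN => /H.
Qed.

Lemma horner_mx_coef n (A : 'M[C]_n.+1) (p : {poly C}) N : (size p <= N)%N ->
  horner_mx A p = \sum_(k < N) p`_k *: A ^+ k.
Proof.
move=> pN; rewrite -{1}[p]coefK poly_def rmorph_sum /=.
rewrite (eq_bigr (fun k : 'I_(size p) => p`_k *: A ^+ k)); last first.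
  by move=> i _; rewrite linearZ /= rmorphXn /= horner_mx_X.
rewrite (big_ord_widen_cond N predT (fun k => p`_k *: A ^+ k) pN).
rewrite [in RHS](bigID (fun i : 'I_N => (i < size p)%N)) /=.
rewrite [X in _ = _ + X]big1 ?addr0 // => i; rewrite -leqNgt => si.
by rewrite nth_default // scale0r.
Qed.

Lemma mxnorm_horner_mx N n (K : R) : 0 <= K -> exists2 c : R, 0 <= c &
  forall (A : 'M[C]_n.+1) (p : {poly C}) B, mxnorm A <= K -> (size p <= N)%N ->
    (forall k, cnorm p`_k <= B) -> mxnorm (horner_mx A p) <= c * B.
Proof.
move=> K0; exists (\sum_(k < N) (n.+1%:R * K) ^+ k).
  by apply: sumr_ge0 => k _; rewrite exprn_ge0 // mulr_ge0.
move=> A p B AK pN pB; rewrite (horner_mx_coef _ pN) mulr_suml.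
apply: le_trans (mxnorm_sum _ _ _) _; apply: ler_sum => k _.
rewrite mxnormZ mulrC ler_pM ?mxnorm_ge0 ?cnorm_ge0 //.
apply: le_trans (mxnormX _ _) _.
by apply: lerXn2r; rewrite ?nnegrE ?mulr_ge0 ?mxnorm_ge0 // ler_wpM2l.
Qed.

(** Transfers an estimate from powers of a matrix to polynomials in it. The weight [phi] and the
    domain [P] are abstract so as to serve for bounds of orders one, two and three. *)
Lemma mxnorm_lincomb (T : Type) (P : T -> Prop) m n (F : nat -> T -> 'M[C]_(m, n))
    (phi : T -> R) : (forall x, 0 <= phi x) ->
  (forall k, exists c : R, forall x, P x -> mxnorm (F k x) <= c * phi x) ->
  forall (a : nat -> C) N, exists2 c : R, 0 <= c &
    forall x, P x -> mxnorm (\sum_(k < N) a k *: F k x) <= c * phi x.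
Proof.
move=> phi0 H a; elim=> [|N [c c0 IH]].
  by exists 0 => // x _; rewrite big_ord0 mxnorm0 mul0r.
have [d dH] := H N; exists (c + cnorm (a N) * `|d|).
  by rewrite addr_ge0 // mulr_ge0 ?cnorm_ge0.
move=> x Px; rewrite big_ord_recr /=; apply: le_trans (mxnormD _ _) _.
rewrite mulrDl lerD ?IH // mxnormZ -mulrA ler_wpM2l ?cnorm_ge0 //.
by apply: le_trans (dH _ Px) _; rewrite ler_wpM2r // ler_norm.
Qed.

Lemma mxnorm_exp_sub n (A : 'M[C]_n.+1) k : exists c : R, forall H,
  mxnorm H <= 1 -> mxnorm ((A + H) ^+ k - A ^+ k) <= c * mxnorm H.
Proof.
elim: k => [|k [c IH]]; first by exists 0 => H _; rewrite subrr mxnorm0 mul0r.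
exists (n.+1%:R * (mxnorm A + 1) * c + n.+1%:R * mxnorm (A ^+ k)) => H H1.
have -> : (A + H) ^+ k.+1 - A ^+ k.+1 = (A + H) * ((A + H) ^+ k - A ^+ k) + H * A ^+ k.
  by rewrite !exprS mulrBr [X in _ - X + _]mulrDl opprD addrA addrNK.
apply: le_trans (mxnormD _ _) _; rewrite [leRHS]mulrDl lerD //.
  apply: le_trans (mxnorm_mulr _ _) _; rewrite -!mulrA ler_wpM2l //.
  rewrite ler_pM ?mxnorm_ge0 ?IH //.
  by apply: le_trans (mxnormD _ _) _; rewrite lerD2l.
by apply: le_trans (mxnorm_mulr _ _) _; rewrite -mulrA [mxnorm H * _]mulrC.
Qed.

Lemma mxnorm_horner_mx_sub n (A : 'M[C]_n.+1) (p : {poly C}) : exists2 c : R, 0 <= c &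
  forall H, mxnorm H <= 1 -> mxnorm (horner_mx (A + H) p - horner_mx A p) <= c * mxnorm H.
Proof.
have [c c0 cP] := mxnorm_lincomb (fun x => mxnorm_ge0 x) (mxnorm_exp_sub A)
  (fun k => p`_k) (size p).
exists c => // H /cP; congr (mxnorm _ <= _).
rewrite !(horner_mx_coef _ (leqnn _)) -sumrB; apply: eq_bigr => k _.
by rewrite scalerBr.
Qed.

(** A left eigenvector [v] satisfies [v *m horner_mx A p = p.[x] *: v]; take norms and cancel that
    of [v]. *)
Lemma eigenvalue_horner_le n (A : 'M[C]_n.+1) (p : {poly C}) x : eigenvalue A x ->
  cnorm p.[x] <= n.+1%:R * mxnorm (horner_mx A p).
Proof.
move=> /eigenvalueP[v vA v0].
have vk k : v *m A ^+ k = x ^+ k *: v.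
  elim: k => [|k IH]; first by rewrite !expr0 mulmx1 scale1r.
  by rewrite exprSr mulmxA IH -scalemxAl vA scalerA exprSr.
have : v *m horner_mx A p = p.[x] *: v.
  rewrite (horner_mx_coef _ (leqnn _)) mulmx_sumr horner_coef scaler_suml.
  by apply: eq_bigr => k _; rewrite -scalemxAr vk scalerA.
move=> /(congr1 (@mxnorm _ _)); rewrite mxnormZ => E.
have := mxnormM v (horner_mx A p); rewrite E [mxnorm v * _]mulrC mulrA.
by rewrite ler_pM2r // mxnorm_gt0.
Qed.

Lemma horner_prod_small_root (s : seq C) x (d : R) : 0 < d ->
  cnorm (\prod_(z <- s) ('X - z%:P)).[x] < d ^+ size s ->
  exists2 z, z \in s & cnorm (x - z) < d.
Proof.
move=> d0; elim: s => [|z s IH]; first by rewrite big_nil hornerC cnorm1 ltxx.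
rewrite big_cons hornerM hornerXsubC cnormM /= exprS => H.
have [xz|xz] := ltP (cnorm (x - z)) d; first by exists z; rewrite ?mem_head.
have [|z' zs xz'] := IH; last by exists z' => //; rewrite inE zs orbT.
rewrite -(ltr_pM2l d0); apply: le_lt_trans H.
by rewrite ler_wpM2r ?cnorm_ge0.
Qed.

End MatrixNorm.

(** * Local approximation of a matrix function by a polynomial *)

Section LocalApproximation.
Variable R : realType.
Local Notation C := R[i].

Lemma common_radius (T : eqType) (P : T -> R -> Prop) (s : seq T) :
  (forall z r r', 0 < r' -> r' <= r -> P z r -> P z r') ->
  {in s, forall z, exists2 r, 0 < r & P z r} ->
  exists2 r, 0 < r & {in s, forall z, P z r}.
Proof.
move=> mon; elim: s => [|z s IH] H; first by exists 1.
have [r r0 Pr] := H z (mem_head _ _).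
have [|r' r'0 Pr'] := IH; first by move=> y ys; apply: H; rewrite inE ys orbT.
have m0 : 0 < Num.min r r' by rewrite lt_min r0.
exists (Num.min r r') => // y; rewrite inE => /predU1P[->|ys].
  by apply: mon Pr => //; rewrite ge_min lexx.
by apply: mon (Pr' y ys) => //; rewrite ge_min lexx orbT.
Qed.

(** Taking [rho^-1] as the coefficient bound leaves a single parameter: a smaller radius also
    weakens the bound, so the property passes to smaller radii and a common one exists for finitely
    many centers. *)
Lemma analytic_pseries_family (Omega : set C) (f : C -> C) (s : seq C) :
  open Omega -> analytic_on Omega f -> {in s, forall z, Omega z} ->
  exists rho, [/\ 0 < rho,
    {in s &, forall x y : C, x != y -> 3 * rho <= cnorm (x - y)},
    pseries_family s rho rho^-1 (fun z w => f (z + w)) &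
    {in s, forall z w, cnorm w < rho -> Omega (z + w)}].
Proof.
move=> Oo fO sO.
have sep : {in s, forall x : C, exists2 r, 0 < r &
    {in s, forall y : C, x != y -> 3 * r <= cnorm (x - y)}}.
  move=> x xs; apply: common_radius.
    move=> y r r' r'0 rr H xy; apply: le_trans (H xy); lra.
  move=> y ys; have [->|xy] := eqVneq x y; first by exists 1.
  exists (cnorm (x - y) / 3); last by move=> _; rewrite mulrC divfK.
  by rewrite divr_gt0 // cnorm_gt0 subr_eq0.
have [r1 r10 P1] := common_radius (P := fun (x : C) r =>
  {in s, forall y : C, x != y -> 3 * r <= cnorm (x - y)})
  (fun x r r' _ rr H y ys xy => le_trans (ler_wpM2l (ler0n R 3) rr) (H y ys xy)) sep.
have [r2 r20 P2] : exists2 r, 0 < r & {in s, forall z,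
    (exists a, has_pseries r r^-1 a (fun w => f (z + w))) /\
    forall w, cnorm w < r -> Omega (z + w)}.
  apply: common_radius.
    move=> z r r' r'0 rr [[a Ha] HO]; split; last first.
      by move=> w wr; apply: HO; exact: lt_le_trans rr.
    exists a; apply: has_pseries_weaken Ha => //.
    by rewrite lef_pV2 // posrE // (lt_le_trans r'0).
  move=> z zs; have Oz := sO z zs.
  have [a [r [M [r0 Hr]]]] := analytic_has_pseries fO Oz.
  have /nbhs_cnormP[t t0 Ht] : nbhs z Omega by exact: open_nbhs_nbhs.
  have M0 := has_pseries_ge0 Hr.
  have M1 : 0 < (M + 1)^-1 by rewrite invr_gt0; lra.
  (* The last term ensures that the inverse of the chosen radius is at least [M]. *)
  exists (Num.min (Num.min r t) (M + 1)^-1); first by rewrite !lt_min r0 t0.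
  set u := Num.min _ _.
  have u0 : 0 < u by rewrite !lt_min r0 t0.
  have [ur ut uM] : [/\ u <= r, u <= t & u <= (M + 1)^-1].
    by split; rewrite !ge_min lexx ?orbT.
  split; last by move=> w wu; apply: Ht; rewrite [z + w]addrC addrK; exact: lt_le_trans ut.
  exists a; apply: has_pseries_weaken Hr => //.
  have : M + 1 <= u^-1 by rewrite -[M + 1]invrK lef_pV2.
  lra.
exists (Num.min r1 r2).
have m0 : 0 < Num.min r1 r2 by rewrite lt_min r10.
have [m1 m2] : Num.min r1 r2 <= r1 /\ Num.min r1 r2 <= r2.
  by split; rewrite ge_min lexx ?orbT.
split=> //.
- by move=> x y xs ys xy; apply: le_trans (P1 x xs y ys xy); lra.
- move=> z zs; have [[a Ha] _] := P2 z zs; exists a.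
  by apply: has_pseries_weaken Ha => //; rewrite lef_pV2.
- by move=> z zs w wm; have [_] := P2 z zs; apply; exact: lt_le_trans m2.
Qed.

(* The polynomial interpolates [f] at three copies of [s]; it does not depend on
   the size of the matrix, so that it serves for [A0] and for the block matrix
   [X1] simultaneously. *)
Lemma mxfun_approx (Omega : set C) (f : C -> C) (s : seq C) :
  open Omega -> analytic_on Omega f -> {in s, forall z, Omega z} ->
  exists p : {poly C}, forall n (A : 'M[C]_n.+1),
    horner_mx A (\prod_(z <- s) ('X - z%:P)) = 0 ->
    exists c r : R, [/\ 0 <= c, 0 < r & forall H, mxnorm H < r ->
      mxnorm (mxfun f (A + H) - horner_mx (A + H) p) <= c * mxnorm H ^+ 3].
Proof.
move=> Oo fO sO; have [rho [r0 sep fF fOm]] := analytic_pseries_family Oo fO sO.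
set q := \prod_(z <- s) _.
have [B1 B10 NI1] := newton_interpolation r0 sep (size (s ++ s ++ s)).
have [|p [G1 [_ _ [M1 G1M] fG1]]] := NI1 _ _ (s ++ s ++ s) erefl fF.
  move=> mu; rewrite !mem_cat !orbb => mus; exists mu => //.
  by rewrite subrr cnorm0; lra.
have {}fG1 : {in s, forall z w, cnorm w < rho ->
    f (z + w) = p.[z + w] + (q ^+ 3).[z + w] * G1 z w}.
  by move=> z zs w wr; rewrite (fG1 z zs w wr) !big_cat /= exprS expr2.
exists p => n A qA.
(* The second interpolation takes place at the [n.+1] eigenvalues of [A + H]; its constant is fixed
   before [H], so that the final estimate is uniform in [H]. *)
have [B B0 NI] := newton_interpolation r0 sep n.+1.
have [L L0 qL] := mxnorm_horner_mx_sub A q.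
have [D D0 DP] := @mxnorm_horner_mx R n.+1 n (mxnorm A + 1) (addr_ge0 (mxnorm_ge0 _) ler01).
have M1B : exists2 M, 0 <= M & pseries_family s rho M G1.
  exists `|M1|; first exact: normr_ge0.
  move=> z zs; have [a Ha] := G1M z zs; exists a.
  exact: has_pseries_weaken r0 (lexx _) (ler_norm _) Ha.
have {M1 G1M M1B} [M1 M10 G1M] := M1B.
(* If [q] has modulus below [d] at a point, one of its [size s] linear factors is below [rho / 4]
   there, which keeps the eigenvalues of [A + H] close to the centers. *)
pose d := (rho / 4) ^+ size s.
have d0 : 0 < d by rewrite exprn_gt0 //; lra.
pose nn : R := n.+1%:R.
have nn0 : 0 < nn by rewrite ltr0n.
pose r := Num.min 1 (d / (nn * (L + 1))).
have r_gt0 : 0 < r by rewrite lt_min ltr01 divr_gt0 // mulr_gt0 //; lra.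
(* Each of the three factors [q] contributes [L * mxnorm H], the polynomial [g] contributes
   [D * (B * M1)], and each of the three matrix products a factor [nn]. *)
exists (nn * (nn * (L * (L * L))) * (nn * (D * (B * M1)))), r; split=> //.
  by rewrite !mulr_ge0 // ltW.
move=> H Hr.
have [H1 Hd] : mxnorm H <= 1 /\ nn * (L * mxnorm H) < d.
  move: Hr; rewrite lt_min => /andP[H1 H2]; split; first exact: ltW.
  move: H2; rewrite ltr_pdivlMr; last by rewrite mulr_gt0 //; lra.
  apply: le_lt_trans; rewrite [leRHS]mulrC -mulrA ler_wpM2l ?(ltW nn0) //.
  by rewrite ler_wpM2r ?mxnorm_ge0 //; lra.
have qH : mxnorm (horner_mx (A + H) q) <= L * mxnorm H.
  by have := qL H H1; rewrite qA subr0.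
have [t tE] := closed_field_poly_normal (char_poly (A + H)).
rewrite (monicP (char_poly_monic _)) scale1r in tE.
have st : size t = n.+1.
  by apply: succn_inj; rewrite -(size_prod_XsubC t id) -tE size_char_poly.
have ev x : eigenvalue (A + H) x -> exists2 z : C, z \in s & cnorm (x - z) < rho / 4.
  move=> xe; apply: horner_prod_small_root; first lra.
  apply: le_lt_trans (eigenvalue_horner_le q xe) _; apply: le_lt_trans Hd.
  by rewrite ler_wpM2l // ltW.
have [|g [G2 [gn gB [M2 G2M] G1G2]]] := NI _ _ t st G1M.
  move=> x xt; have [|z zs xz] := ev x; last by exists z => //; lra.
  by rewrite eigenvalue_root_char tE root_prod_XsubC.
(* The remainder of the two interpolations is a bounded function times [q ^+ 3] times the
   characteristic polynomial of [A + H], a multiple of the minimal polynomial. *)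
have -> : mxfun f (A + H) = horner_mx (A + H) (p + q ^+ 3 * g).
  apply: (@mxfun_interp_near _ _ _ _ _ (q ^+ 3 * \prod_(mu <- t) ('X - mu%:P))).
    by rewrite -tE dvdp_mull // mxminpoly_dvd_char.
  move=> x xe; have [z zs xz] := ev x xe.
  have Ox : Omega x by rewrite -[x](subrKC z); apply: fOm => //; lra.
  have [a [u [M [u0 Ha]]]] := analytic_has_pseries fO Ox.
  (* The eigenvalue [x] is within [rho / 4] of [z], so [x + w] stays within [rho / 2] of [z], where
     [G2 z] is bounded by [2 * M2]. *)
  pose v := Num.min u (rho / 4).
  have v0 : 0 < v by rewrite lt_min u0 /=; lra.
  exists a, v, M, (2 * M2), (fun w => G2 z (x - z + w)); split=> //.
    by apply: has_pseries_weaken Ha => //; rewrite ge_min lexx.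
  move=> w; rewrite lt_min => /andP[_ w4].
  have xzw : cnorm (x - z + w) <= rho / 2 by have := cnormD (x - z) w; lra.
  have xzw' : cnorm (x - z + w) < rho by lra.
  have xE : x + w = z + (x - z + w) by ring.
  split; last first.
    by have [b Hb] := G2M z zs; exact: has_pseries_bound Hb r0 xzw.
  rewrite xE fG1 // G1G2 // !hornerE; ring.
rewrite rmorphD addrAC subrr add0r rmorphM rmorphXn /=.
have gD : mxnorm (horner_mx (A + H) g) <= D * (B * M1).
  apply: DP gn gB; apply: le_trans (mxnormD _ _) _; lra.
set Q := horner_mx _ q in qH *; set h := mxnorm H in qH *.
have h0 : 0 <= h by exact: mxnorm_ge0.
have Q3 : mxnorm (Q ^+ 3) <= nn * (nn * (L * (L * L))) * h ^+ 3.
  have -> : nn * (nn * (L * (L * L))) * h ^+ 3 = nn * (L * h * (nn * (L * h * (L * h)))).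
    by ring.
  rewrite exprS expr2; apply: le_trans (mxnorm_mulr _ _) _.
  rewrite ler_wpM2l ?(ltW nn0) // ler_pM ?mxnorm_ge0 //.
  apply: le_trans (mxnorm_mulr _ _) _.
  by rewrite ler_wpM2l ?(ltW nn0) // ler_pM ?mxnorm_ge0.
apply: le_trans (mxnorm_mulr _ _) _.
rewrite [leRHS]mulrAC mulrC.
have -> : mxnorm (Q ^+ 3) * mxnorm (horner_mx (A + H) g) * n.+1%:R =
  mxnorm (Q ^+ 3) * (nn * mxnorm (horner_mx (A + H) g)) by rewrite /nn; ring.
apply: ler_pM => //; rewrite ?mulr_ge0 ?mxnorm_ge0 ?(ltW nn0) //.
by rewrite ler_wpM2l // ltW.
Qed.

End LocalApproximation.

(** * Differential and complex step for polynomials *)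

Section PolynomialDifferential.
Variables (R : realType) (n : nat) (A : 'M[R[i]]_n.+1).
Local Notation C := R[i].
Local Notation M := 'M[C]_n.+1.
Implicit Types (H : M) (p : {poly C}).

(** The derivative of the [k]-th power at [A], that is the sum of [A ^+ i * H * A ^+ j] over
    [i + j = k - 1], in a recursive form that follows [exprS]. *)
Fixpoint expmx_diff k H : M :=
  if k is k'.+1 then A * expmx_diff k' H + H * A ^+ k' else 0.

Definition horner_mx_diff p H : M := \sum_(k < size p) p`_k *: expmx_diff k H.

Lemma expmx_diff_is_linear k : linear (expmx_diff k).
Proof.
move=> a H H'; elim: k => [|k IH] /=; first by rewrite scaler0 addr0.
by rewrite IH mulrDr mulrDl -scalerAr -scalerAl scalerDr addrACA.
Qed.

Lemma horner_mx_diff_is_linear p : linear (horner_mx_diff p).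
Proof.
move=> a H H'; rewrite /horner_mx_diff scaler_sumr -big_split /=.
apply: eq_bigr => k _; rewrite expmx_diff_is_linear scalerDr.
by rewrite !scalerA [a * _]mulrC.
Qed.

HB.instance Definition _ p := GRing.isLinear.Build C M M *:%R (horner_mx_diff p)
  (horner_mx_diff_is_linear p).

(** The premise [True] gives the statement the shape expected by [mxnorm_lincomb]. *)
Lemma mxnorm_expmx_diff k : exists c : R, forall H, True ->
  mxnorm (expmx_diff k H) <= c * mxnorm H.
Proof.
elim: k => [|k [c IH]]; first by exists 0 => H _; rewrite /= mxnorm0 mul0r.
exists (n.+1%:R * mxnorm A * c + n.+1%:R * mxnorm (A ^+ k)) => H _ /=.
apply: le_trans (mxnormD _ _) _; rewrite [leRHS]mulrDl lerD //.
  apply: le_trans (mxnorm_mulr _ _) _; rewrite -!mulrA ler_wpM2l //.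
  by rewrite ler_wpM2l ?mxnorm_ge0 ?IH.
by apply: le_trans (mxnorm_mulr _ _) _; rewrite -mulrA [mxnorm H * _]mulrC.
Qed.

Lemma mxnorm_expmx_diff_remainder k : exists c : R, forall H, mxnorm H <= 1 ->
  mxnorm ((A + H) ^+ k - A ^+ k - expmx_diff k H) <= c * mxnorm H ^+ 2.
Proof.
elim: k => [|k [c IH]]; first by exists 0 => H _; rewrite /= subrr subr0 mxnorm0 mul0r.
have [d dP] := mxnorm_exp_sub A k.
exists (n.+1%:R * mxnorm A * c + n.+1%:R * d) => H H1 /=.
have -> : (A + H) ^+ k.+1 - A ^+ k.+1 - (A * expmx_diff k H + H * A ^+ k) =
    A * ((A + H) ^+ k - A ^+ k - expmx_diff k H) + H * ((A + H) ^+ k - A ^+ k).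
  by rewrite !exprS mulrDl !mulrBr opprD [_ + _ - _]addrAC addrACA.
apply: le_trans (mxnormD _ _) _; rewrite [leRHS]mulrDl lerD //.
  apply: le_trans (mxnorm_mulr _ _) _; rewrite -!mulrA ler_wpM2l //.
  by rewrite ler_wpM2l ?mxnorm_ge0 ?IH.
apply: le_trans (mxnorm_mulr _ _) _; rewrite -!mulrA ler_wpM2l //.
by rewrite expr2 [leRHS]mulrCA ler_wpM2l ?mxnorm_ge0 ?dP.
Qed.

Lemma mxnorm_horner_mx_diff p : exists2 c : R, 0 <= c &
  forall H, mxnorm (horner_mx_diff p H) <= c * mxnorm H.
Proof.
have [c c0 cP] := mxnorm_lincomb (fun x => mxnorm_ge0 x) mxnorm_expmx_diff
  (fun k => p`_k) (size p).
by exists c => // H; exact: cP.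
Qed.

Lemma mxnorm_horner_mx_diff_remainder p : exists2 c : R, 0 <= c &
  forall H, mxnorm H <= 1 ->
  mxnorm (horner_mx (A + H) p - horner_mx A p - horner_mx_diff p H) <= c * mxnorm H ^+ 2.
Proof.
have [c c0 cP] := mxnorm_lincomb (fun x : M => exprn_ge0 2 (mxnorm_ge0 x))
  mxnorm_expmx_diff_remainder (fun k => p`_k) (size p).
exists c => // H /cP; congr (mxnorm _ <= _).
rewrite !(horner_mx_coef _ (leqnn _)) -!sumrB; apply: eq_bigr => k _.
by rewrite !scalerBr.
Qed.

Lemma continuous_horner_mx_diff p : continuous (horner_mx_diff p).
Proof.
have [c c0 cP] := mxnorm_horner_mx_diff p.
apply/linear_bounded_continuous; exists c%:C; split.
  by apply/complex_realP; exists c.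
move=> k ck; apply/nbhs_mxnormP; exists 1 => // H; rewrite subr0 => H1 /=.
apply: le_trans (ltW ck); rewrite mxnormE lecR; apply: le_trans (cP H) _.
by rewrite ler_piMr // ltW.
Qed.

(** The cubic error is negligible at first order, so [F] inherits the differential of the
    polynomial. One little-o estimate is used twice: to identify ['d F A], and then to obtain
    differentiability. *)
Lemma diff_polynomial_approx (F : M -> M) p (c r : R) : 0 <= c -> 0 < r ->
  (forall H, mxnorm H < r ->
    mxnorm (F (A + H) - horner_mx (A + H) p) <= c * mxnorm H ^+ 3) ->
  differentiable F A /\ 'd F A = horner_mx_diff p :> (M -> M).
Proof.
move=> c0 r0 FP; have [d d0 dP] := mxnorm_horner_mx_diff_remainder p.
(* The hypothesis at [H = 0], where its right-hand side vanishes. *)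
have FA : F A = horner_mx A p.
  apply/eqP; rewrite -subr_eq0 -[_ == _]negbK -mxnorm_gt0 -leNgt.
  by have := FP 0; rewrite addr0 mxnorm0 expr0n mulr0; apply.
have FE (eps : C) : 0 < eps -> \forall H \near (0 : M),
    `|F (H + A) - (F A + horner_mx_diff p H)| <= eps * `|H|.
  move=> /gt0_complexE[e e0 ->]; apply/nbhs_mxnormP.
  have cd1 : 0 < c + d + 1 by lra.
  exists (Num.min (Num.min r 1) (e / (c + d + 1))).
    by rewrite !lt_min r0 ltr01 divr_gt0.
  move=> H; rewrite subr0 !lt_min -andbA => /and3P[Hr H1 He].
  rewrite /= !mxnormE -rmorphM /= lecR.
  rewrite [H + A]addrC FA.
  have -> : F (A + H) - (horner_mx A p + horner_mx_diff p H) =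
    F (A + H) - horner_mx (A + H) p +
    (horner_mx (A + H) p - horner_mx A p - horner_mx_diff p H).
    by rewrite opprD !addrA addrNK.
  apply: le_trans (mxnormD _ _) _.
  apply: le_trans (lerD (FP H Hr) (dP H (ltW H1))) _.
  move: He; rewrite ltr_pdivlMr //; have := mxnorm_ge0 H.
  set x := mxnorm H in H1 *; rewrite exprS => x0 xe.
  have : c * (x * x ^+ 2) <= c * x ^+ 2.
    by rewrite ler_wpM2l // ler_piMl ?exprn_ge0 // ltW.
  rewrite expr2; nra.
have dF : 'd F A = horner_mx_diff p :> (M -> M).
  have := @diff_unique _ _ _ F (horner_mx_diff p : {linear M -> M}) A
    (@continuous_horner_mx_diff p).
  by apply; apply/eqaddoP; exact: FE.
split=> //; apply/diff_locallyP; rewrite dF; split; first exact: continuous_horner_mx_diff.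
by apply/eqaddoP; exact: FE.
Qed.

End PolynomialDifferential.

(** * Powers of the complex step block matrix *)

Section ComplexStep.
Variables (R : realType) (n : nat) (A E : 'M[R[i]]_n.+1).
Local Notation C := R[i].

(** The size is convertible to [n.+1 + n.+1], but its form as a successor gives access to the ring
    of square matrices. *)
Definition block_diag2 : 'M[C]_((n + n.+1).+1) :=
  @block_mx _ n.+1 n.+1 n.+1 n.+1 A 0 0 A.

Lemma block_diag2_exp k :
  block_diag2 ^+ k = @block_mx _ n.+1 n.+1 n.+1 n.+1 (A ^+ k) 0 0 (A ^+ k).
Proof.
elim: k => [|k IH]; first by rewrite !expr0 -scalar_mx_block.
rewrite exprS IH; apply: etrans (mulmx_block A 0 0 A (A ^+ k) 0 0 (A ^+ k)) _.
by rewrite !mul0mx !mulmx0 !addr0 !add0r exprS.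
Qed.

Lemma horner_block_diag2 (p : {poly C}) : horner_mx A p = 0 -> horner_mx block_diag2 p = 0.
Proof.
move=> Ap; pose bd (X : 'M[C]_n.+1) : 'M[C]_((n + n.+1).+1) :=
  @block_mx _ n.+1 n.+1 n.+1 n.+1 X 0 0 X.
have bdD X Y : bd X + bd Y = bd (X + Y).
  apply: etrans (@add_block_mx C n.+1 n.+1 n.+1 n.+1 X 0 0 X Y 0 0 Y) _.
  by rewrite !addr0.
have bdZ a X : a *: bd X = bd (a *: X).
  by apply: etrans (@scale_block_mx C n.+1 n.+1 n.+1 n.+1 a X 0 0 X) _; rewrite !scaler0.
have bd0 : bd 0 = 0 by exact: (@block_mx0 C n.+1 n.+1 n.+1 n.+1).
rewrite (horner_mx_coef _ (leqnn _)).
under eq_bigr do rewrite block_diag2_exp -/(bd _) bdZ.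
rewrite -(big_morph bd (fun X Y => esym (bdD X Y)) bd0).
by rewrite -(horner_mx_coef _ (leqnn _)) Ap.
Qed.

(** Blocks [X], [Y], [- Y], [X] multiply like [X + i Y], so the power expands like that of
    [A + i h E]: diagonal blocks are even in [h], the others odd, and no term in [h ^+ 2] follows
    the linear one. [U] and [V] depend on [h]; only their bound is uniform. *)
Lemma cstep_mx_exp k : exists2 c : R, 0 <= c & forall h : R, `|h| <= 1 ->
  exists U V : 'M[C]_n.+1, [/\ mxnorm U <= c, mxnorm V <= c &
    (cstep_mx A E h : 'M[C]_((n + n.+1).+1)) ^+ k = @block_mx _ n.+1 n.+1 n.+1 n.+1
      (A ^+ k + h%:C ^+ 2 *: U) (h%:C *: expmx_diff A k E + h%:C ^+ 3 *: V)
      (- (h%:C *: expmx_diff A k E + h%:C ^+ 3 *: V)) (A ^+ k + h%:C ^+ 2 *: U)].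
Proof.
elim: k => [|k [c c0 IH]].
  exists 0 => // h _; exists 0, 0; split; rewrite ?mxnorm0 //=.
  by rewrite !scaler0 !addr0 oppr0 !expr0 -scalar_mx_block.
pose a := mxnorm A; pose e := mxnorm E; pose D := expmx_diff A k E.
have [a0 e0] : 0 <= a /\ 0 <= e by rewrite !mxnorm_ge0.
exists (n.+1%:R * (a * c) + n.+1%:R * (e * (mxnorm D + c))).
  by rewrite addr_ge0 // !mulr_ge0 ?addr_ge0 ?mxnorm_ge0.
move=> h h1; have [U [V [Uc Vc XE]]] := IH h h1.
have hc m : cnorm (h%:C ^+ m) <= 1.
  by rewrite cnormX cnorm_real exprn_ile1.
(* The terms of order at least two, respectively three, in the first block row of the product, with
   [h%:C ^+ 2] and [h%:C ^+ 3] taken out. *)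
exists (A * U - E * (D + h%:C ^+ 2 *: V)), (A * V + E * U); split.
- apply: le_trans (mxnormD _ _) _; rewrite mxnormN lerD //.
    by apply: le_trans (mxnorm_mulr _ _) _; rewrite !ler_wpM2l.
  apply: le_trans (mxnorm_mulr _ _) _; rewrite !ler_wpM2l //.
  apply: le_trans (mxnormD _ _) _; rewrite lerD2l mxnormZ.
  by apply: le_trans Vc; rewrite ler_piMl ?mxnorm_ge0.
- apply: le_trans (mxnormD _ _) _; rewrite lerD //.
    by apply: le_trans (mxnorm_mulr _ _) _; rewrite !ler_wpM2l.
  apply: le_trans (mxnorm_mulr _ _) _; rewrite !ler_wpM2l //.
  by apply: le_trans Uc _; rewrite lerDr mxnorm_ge0.
rewrite exprS XE; set U1 := A ^+ k + _; set V1 := h%:C *: _ + _.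
apply: etrans (mulmx_block A (h%:C *: E) (- (h%:C *: E)) A U1 V1 (- V1) U1) _.
have UE : A *m U1 - h%:C *: E *m V1 =
    A ^+ k.+1 + h%:C ^+ 2 *: (A * U - E * (D + h%:C ^+ 2 *: V)).
  have V1E : V1 = h%:C *: (D + h%:C ^+ 2 *: V) by rewrite scalerDr scalerA -exprS.
  rewrite !mulmxE V1E /U1 mulrDr -exprS -scalerAr -scalerAl -scalerAr.
  by rewrite scalerA -expr2 -addrA -scalerBr.
have VE : A *m V1 + h%:C *: E *m U1 =
    h%:C *: expmx_diff A k.+1 E + h%:C ^+ 3 *: (A * V + E * U).
  rewrite !mulmxE /U1 /V1 /= -/D mulrDr -!scalerAl !mulrDr -!scalerAr.
  by rewrite !scalerDr !scalerA -exprS addrACA.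
congr (block_mx _ _ _ _).
- by rewrite mulmxN UE.
- by rewrite VE.
- by rewrite -VE mulmxN mulNmx addrC -opprD.
- by rewrite mulNmx addrC UE.
Qed.

Lemma mxnorm_ursubmx m1 m2 n1 n2 (X : 'M[C]_(m1 + m2, n1 + n2)) :
  mxnorm (ursubmx X) <= mxnorm X.
Proof.
apply: mxnorm_le => [|i j]; first exact: mxnorm_ge0.
by rewrite !mxE cnorm_entry.
Qed.

Lemma mxnorm_horner_cstep (p : {poly C}) : exists2 c : R, 0 <= c &
  forall h : R, `|h| <= 1 ->
  mxnorm (@ursubmx _ n.+1 n.+1 n.+1 n.+1 (horner_mx (cstep_mx A E h : 'M[C]_((n + n.+1).+1)) p)
    - h%:C *: horner_mx_diff A p E) <= c * `|h| ^+ 3.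
Proof.
pose F k (h : R) := @ursubmx _ n.+1 n.+1 n.+1 n.+1
    ((cstep_mx A E h : 'M[C]_((n + n.+1).+1)) ^+ k) - h%:C *: expmx_diff A k E.
have FP k : exists c : R, forall h : R, `|h| <= 1 -> mxnorm (F k h) <= c * `|h| ^+ 3.
  have [c c0 cP] := cstep_mx_exp k; exists c => h /cP[U [V [_ Vc XE]]].
  rewrite /F XE block_mxKur addrAC subrr add0r mxnormZ cnormX cnorm_real mulrC.
  by rewrite ler_wpM2r // exprn_ge0.
have [c c0 cP] := mxnorm_lincomb (P := fun h : R => `|h| <= 1)
  (fun h : R => exprn_ge0 3 (normr_ge0 h)) FP (fun k => p`_k) (size p).
exists c => // h /cP; congr (mxnorm _ <= _).
rewrite (horner_mx_coef _ (leqnn _)) /horner_mx_diff scaler_sumr.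
elim: (size p) => [|N IH].
  by rewrite !big_ord0 subr0; apply/matrixP => i j; rewrite !mxE.
rewrite !big_ord_recr /= IH /F; apply/matrixP => i j; rewrite !mxE; ring.
Qed.

End ComplexStep.

Theorem mainTheorem6 (R : realType) (n : nat) (A0 E1 : 'M[R[i]]_n.+1)
    (Omega : set R[i]) (f : R[i] -> R[i]) :
  open Omega -> spectrum A0 `<=` Omega ->
  analytic_on Omega f -> real_on_real Omega f ->
  differentiable (@mxfun R n f) A0 /\
  forall h : R, 'd (@mxfun R n f) A0 E1 =
    (h%:C)^-1 *: @ursubmx _ n.+1 n.+1 n.+1 n.+1 (@mxfun R (n + n.+1) f (cstep_mx A0 E1 h))
      +O_(h \near 0^') (h%:C ^+ 2).
Proof.
move=> Oo specO fO _.
have [s sE] := closed_field_poly_normal (char_poly A0).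
rewrite (monicP (char_poly_monic _)) scale1r in sE.
have sO : {in s, forall z, Omega z}.
  move=> z zs; apply: specO; rewrite /spectrum /= eigenvalue_root_char sE.
  by rewrite root_prod_XsubC.
have [p pP] := mxfun_approx Oo fO sO.
have qA : horner_mx A0 (\prod_(z <- s) ('X - z%:P)) = 0.
  by rewrite -sE Cayley_Hamilton.
have [c [r [c0 r0 cP]]] := pP _ _ qA.
have [fd dfE] := diff_polynomial_approx c0 r0 cP; split=> //.
(* The same [p] serves at the doubled size, since the polynomial that annihilates [A0] also
   annihilates [block_diag2 A0]. *)
have [b [t [b0 t0 bP]]] := pP _ _ (horner_block_diag2 qA).
have [d d0 dP] := mxnorm_horner_cstep A0 E1 p.
rewrite dfE.
pose e := mxnorm E1; have e0 : 0 <= e by exact: mxnorm_ge0.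
(* The first term comes from replacing [f] by [p] at distance at most [|h| * e] from the block
   diagonal matrix, the second from the complex step for [p]; both errors are cubic in [h] before
   the division by [h]. *)
pose K := b * e ^+ 3 + d.
have K0 : 0 <= K by rewrite addr_ge0 // mulr_ge0 // exprn_ge0.
(* The denominator [e + 1] keeps the radius positive and meaningful when [E1 = 0]. *)
have main (h : R) : h != 0 -> `|h| < 1 -> `|h| < t / (e + 1) ->
    mxnorm (horner_mx_diff A0 p E1 - (h%:C)^-1 *: @ursubmx _ n.+1 n.+1 n.+1 n.+1
      (@mxfun R (n + n.+1) f (cstep_mx A0 E1 h))) <= K * `|h| ^+ 2.
  move=> h0 h1 ht.
  pose N : 'M[R[i]]_((n + n.+1).+1) :=
    @block_mx _ n.+1 n.+1 n.+1 n.+1 0 (h%:C *: E1) (- (h%:C *: E1)) 0.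
  have XE : cstep_mx A0 E1 h = block_diag2 A0 + N.
    apply: esym; apply: etrans (@add_block_mx _ n.+1 n.+1 n.+1 n.+1 A0 0 0 A0
      0 (h%:C *: E1) (- (h%:C *: E1)) 0) _.
    by rewrite !addr0 !add0r.
  have Ne : mxnorm N <= `|h| * e.
    have he : mxnorm (h%:C *: E1) = `|h| * e by rewrite mxnormZ cnorm_real.
    apply: mxnorm_le => [|i j]; first by rewrite mulr_ge0.
    rewrite /N !mxE; case: splitP => i' _; rewrite !mxE; case: splitP => j' _.
    - by rewrite mxE cnorm0 mulr_ge0.
    - by rewrite -he cnorm_entry.
    - by rewrite -he -mxnormN cnorm_entry.
    - by rewrite mxE cnorm0 mulr_ge0.
  have Nt : mxnorm N < t.
    apply: le_lt_trans Ne _; move: ht; rewrite ltr_pdivlMr; last lra.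
    by apply: le_lt_trans; rewrite ler_wpM2l //; lra.
  have h_gt0 : 0 < `|h| by rewrite normr_gt0.
  have hC0 : h%:C != 0 :> R[i] by rewrite -cnorm_gt0 cnorm_real.
  set Y := mxfun f _; set D := horner_mx_diff A0 p E1.
  have Yp : mxnorm (Y - horner_mx (cstep_mx A0 E1 h : 'M[R[i]]_((n + n.+1).+1)) p) <=
      b * e ^+ 3 * `|h| ^+ 3.
    rewrite /Y XE; apply: le_trans (bP N Nt) _.
    rewrite -mulrA -exprMn ler_wpM2l // [e * _]mulrC.
    by apply: lerXn2r; rewrite ?nnegrE ?mxnorm_ge0 ?mulr_ge0.
  have := dP h (ltW h1); rewrite -/D.
  have := mxnorm_ursubmx (m1 := n.+1) (m2 := n.+1) (n1 := n.+1) (n2 := n.+1)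
    (Y - horner_mx (cstep_mx A0 E1 h : 'M[R[i]]_((n + n.+1).+1)) p).
  move=> /le_trans /(_ Yp); set Z := horner_mx _ p => H1 H2.
  have -> : D - (h%:C)^-1 *: @ursubmx _ n.+1 n.+1 n.+1 n.+1 Y =
    - ((h%:C)^-1 *: (@ursubmx _ n.+1 n.+1 n.+1 n.+1 (Y - Z) +
      (@ursubmx _ n.+1 n.+1 n.+1 n.+1 Z - h%:C *: D))).
    by apply/matrixP => i j; rewrite !mxE; field.
  rewrite mxnormN mxnormZ cnormV cnorm_real mulrC ler_pdivrMr //.
  apply: le_trans (mxnormD _ _) _; apply: le_trans (lerD H1 H2) _.
  by rewrite -[leRHS]mulrA -exprSr /K mulrDl.
have te : 0 < t / (e + 1) by rewrite divr_gt0 //; lra.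
apply: eqaddOEx; apply/funeqP; apply/eqaddOP.
exists K%:C; split; first by apply/complex_realP; exists K.
move=> k Kk; near=> h.
have h0 : h != 0 by near: h; exact: nbhs_dnbhs_neq.
have h1 : `|h| < 1 by near: h; exact: dnbhs0_lt.
have ht : `|h| < t / (e + 1) by near: h; exact: dnbhs0_lt.
have /= := main h h0 h1 ht; rewrite -lecR -mxnormE => /le_trans; apply.
rewrite rmorphM rmorphXn /= cnormE cnormX cnorm_real rmorphXn /=.
by rewrite ler_wpM2r ?(ltW Kk) // exprn_ge0 // ler0c.
Unshelve. all: by end_near. Qed.
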